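(* Let $\mathfrak{P}$ be a compactness-like topological property and let $X$ and $Y$ be locally-$\mathfrak{P}$ spaces, neither of which has $\mathfrak{P}$. If $(\mathscr{E}_\mathfrak{P}(X),\leq)$ and $(\mathscr{E}_\mathfrak{P}(Y),\leq)$ are order-isomorphic, then $\beta X\setminus\lambda_\mathfrak{P}X$ and $\beta Y\setminus\lambda_\mathfrak{P}Y$ are homeomorphic.
   Context: All spaces are completely regular Hausdorff; $\beta X$ is the Stone–Čech compactification. An extension of $X$ is a space containing $X$ as a dense subspace; its remainder is $Y\setminus X$. Extensions are identified up to homeomorphisms fixing $X$ pointwise, and $Y\leq Y'$ means there is a continuous map $Y'\to Y$ fixing $X$ pointwise. For a topological property $\mathfrak{P}$, $\mathscr{E}_\mathfrak{P}(X)$ is the set of all extensions of $X$ with $\mathfrak{P}$ and compact remainder, ordered by $\leq$. $X$ is locally-$\mathfrak{P}$ if each point has an open neighborhood whose closure has $\mathfrak{P}$. $\mathrm{Coz}(X)$ is the set of cozero-sets $X\setminus f^{-1}(0)$, $f:X\to[0,1]$ continuous. Define $\lambda_\mathfrak{P}X=\bigcup\{\mathrm{int}_{\beta X}\mathrm{cl}_{\beta X}C: C\in\mathrm{Coz}(X),\ \mathrm{cl}_XC\text{ has }\mathfrak{P}\}$. A topological property $\mathfrak{P}$ is compactness-like if: it is hereditary to clopen subspaces; it is finitely additive (a space that is a finite disjoint union of closed subspaces each with $\mathfrak{P}$ has $\mathfrak{P}$); it is invariant and inverse invariant under perfect surjections (closed continuous surjections with compact fibers); and it satisfies Mrówka's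 condition (W): if a space $Z$ has a point $p$ with an open base $\mathscr{B}$ at $p$ such that $Z\setminus B$ has $\mathfrak{P}$ for every $B\in\mathscr{B}$, then $Z$ has $\mathfrak{P}$. *)

(* Defs.v *)
From Stdlib Require Import Reals List Classical.

Record Space := {
  carrier :> Type;
  is_open : (carrier -> Prop) -> Prop;
  open_ext : forall U V : carrier -> Prop,
      (forall x, U x <-> V x) -> is_open U -> is_open V;
  open_full : is_open (fun _ => True);
  open_inter : forall U V, is_open U -> is_open V -> is_open (fun x => U x /\ V x);
  open_union : forall F : (carrier -> Prop) -> Prop,
      (forall U, F U -> is_open U) -> is_open (fun x => exists U, F U /\ U x)
}.
Arguments is_open {_} _.

Definition sub_open (S : Space) (A : S -> Prop) (V : {x : S | A x} -> Prop) : Prop :=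
  exists U : S -> Prop, is_open U /\ forall x, V x <-> U (proj1_sig x).

Lemma sub_open_ext (S : Space) (A : S -> Prop) : forall U V : {x : S | A x} -> Prop,
  (forall x, U x <-> V x) -> sub_open S A U -> sub_open S A V.
Proof.
  intros U V H [W [HW HU]]. exists W; split; auto.
  intro x; rewrite <- H; apply HU.
Qed.

Lemma sub_open_full (S : Space) (A : S -> Prop) : sub_open S A (fun _ => True).
Proof. exists (fun _ => True); split; [apply open_full | tauto]. Qed.

Lemma sub_open_inter (S : Space) (A : S -> Prop) : forall U V, sub_open S A U -> sub_open S A V ->
  sub_open S A (fun x => U x /\ V x).
Proof.
  intros U V [U' [HU' HU]] [V' [HV' HV]].
  exists (fun x => U' x /\ V' x); split; [apply open_inter; auto|].
  intro x; rewrite HU, HV; tauto.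
Qed.

Lemma sub_open_union (S : Space) (A : S -> Prop) : forall F : ({x : S | A x} -> Prop) -> Prop,
  (forall U, F U -> sub_open S A U) ->
  sub_open S A (fun x => exists U, F U /\ U x).
Proof.
  intros F HF.
  exists (fun y => exists W, (is_open W /\ exists V, F V /\
            forall x, V x <-> W (proj1_sig x)) /\ W y).
  split.
  - apply open_union. intros W [HW _]; exact HW.
  - intro x; split.
    + intros [V [FV Vx]]. destruct (HF V FV) as [W [HW HVW]].
      exists W; split; [split; [exact HW | exists V; auto] | apply HVW; exact Vx].
    + intros [W [[HW [V [FV HVW]]] Wx]]. exists V; split; auto. apply HVW; exact Wx.
Qed.

Definition subspace (S : Space) (A : S -> Prop) : Space :=
  {| carrier := {x : S | A x};
     is_open := sub_open S A;
     open_ext := sub_open_ext S A;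
     open_full := sub_open_full S A;
     open_inter := sub_open_inter S A;
     open_union := sub_open_union S A |}.

Definition is_closed {S : Space} (A : S -> Prop) : Prop := is_open (fun x => ~ A x).
Definition closure {S : Space} (A : S -> Prop) (x : S) : Prop :=
  forall U, is_open U -> U x -> exists y, U y /\ A y.
Definition interior {S : Space} (A : S -> Prop) (x : S) : Prop :=
  exists U, is_open U /\ U x /\ forall y, U y -> A y.
Definition image {S T : Type} (f : S -> T) (A : S -> Prop) (y : T) : Prop :=
  exists x, A x /\ f x = y.

Definition continuous {S T : Space} (f : S -> T) : Prop :=
  forall V : T -> Prop, is_open V -> is_open (fun x => V (f x)).

(* continuity of a real-valued map (R with its usual topology, generated by open intervals) *)
Definition rcontinuous {S : Space} (f : S -> R) : Prop :=
  forall a b : R, is_open (fun x => (a < f x < b)%R).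

Definition hausdorff (S : Space) : Prop :=
  forall x y : S, x <> y -> exists U V : S -> Prop,
    is_open U /\ is_open V /\ U x /\ V y /\ forall z, U z -> V z -> False.

Definition completely_regular (S : Space) : Prop :=
  forall (A : S -> Prop) (x : S), is_closed A -> ~ A x ->
    exists f : S -> R, rcontinuous f /\ (forall z, (0 <= f z <= 1)%R) /\
      f x = 0%R /\ forall z, A z -> f z = 1%R.

Definition tychonoff (S : Space) : Prop := hausdorff S /\ completely_regular S.

Definition compact_set {S : Space} (A : S -> Prop) : Prop :=
  forall F : (S -> Prop) -> Prop, (forall U, F U -> is_open U) ->
    (forall x, A x -> exists U, F U /\ U x) ->
    exists l : list (S -> Prop), (forall U, In U l -> F U) /\
      forall x, A x -> exists U, In U l /\ U x.

Definition compact (S : Space) : Prop := compact_set (fun _ : S => True).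

Definition closed_map {S T : Space} (f : S -> T) : Prop :=
  forall A, is_closed A -> is_closed (image f A).

Definition perfect_surjection {S T : Space} (f : S -> T) : Prop :=
  continuous f /\ closed_map f /\ (forall y, exists x, f x = y) /\
  forall y, compact_set (fun x => f x = y).

Definition homeomorphism {S T : Space} (f : S -> T) : Prop :=
  exists g : T -> S, continuous f /\ continuous g /\
    (forall x, g (f x) = x) /\ (forall y, f (g y) = y).

Definition homeomorphic (S T : Space) : Prop := exists f : S -> T, homeomorphism f.

Definition embedding {S T : Space} (f : S -> T) : Prop :=
  continuous f /\ (forall x y, f x = f y -> x = y) /\
  forall U, is_open U -> exists V, is_open V /\ forall x, U x <-> V (f x).

Definition dense_map {S T : Space} (f : S -> T) : Prop :=
  forall y, closure (image f (fun _ => True)) y.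

Definition cozero {S : Space} (C : S -> Prop) : Prop :=
  exists f : S -> R, rcontinuous f /\ (forall x, (0 <= f x <= 1)%R) /\
    forall x, C x <-> f x <> 0%R.

Definition locally_P (P : Space -> Prop) (X : Space) : Prop :=
  forall x : X, exists U : X -> Prop, is_open U /\ U x /\ P (subspace X (closure U)).

Definition compactness_like (P : Space -> Prop) : Prop :=
  (forall (Z : Space) (A : Z -> Prop), tychonoff Z -> P Z ->
      is_open A -> is_closed A -> P (subspace Z A)) /\
  (forall (Z : Space) (l : list (Z -> Prop)), tychonoff Z ->
      (forall A, In A l -> is_closed A /\ P (subspace Z A)) ->
      (forall x, exists A, In A l /\ A x) ->
      (forall i j, (i < length l)%nat -> (j < length l)%nat -> i <> j ->
         forall x, nth i l (fun _ => False) x -> nth j l (fun _ => False) x -> False) ->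
      P Z) /\
  (forall (Z W : Space) (f : Z -> W), tychonoff Z -> tychonoff W ->
      perfect_surjection f -> (P Z <-> P W)) /\
  (* Mrowka's condition (W) *)
  (forall (Z : Space) (p : Z) (B : (Z -> Prop) -> Prop), tychonoff Z ->
      (forall U, B U -> is_open U /\ U p) ->
      (forall V, is_open V -> V p -> exists U, B U /\ forall z, U z -> V z) ->
      (forall U, B U -> P (subspace Z (fun z => ~ U z))) ->
      P Z).

Definition is_stone_cech (X B : Space) (e : X -> B) : Prop :=
  compact B /\ hausdorff B /\ embedding e /\ dense_map e /\
  forall (K : Space) (f : X -> K), compact K -> hausdorff K -> continuous f ->
    exists g : B -> K, continuous g /\ forall x, g (e x) = f x.

Record extension (P : Space -> Prop) (X : Space) := {
  ext_space : Space;
  ext_map : X -> ext_space;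
  ext_tych : tychonoff ext_space;
  ext_emb : embedding ext_map;
  ext_dense : dense_map ext_map;
  ext_rem : compact_set (fun y => ~ exists x, ext_map x = y);
  ext_P : P ext_space
}.
Arguments ext_space {P X} _.
Arguments ext_map {P X} _ _.

Definition ext_le {P X} (A A' : extension P X) : Prop :=
  exists f : ext_space A' -> ext_space A, continuous f /\
    forall x, f (ext_map A' x) = ext_map A x.

Definition ext_equiv {P X} (A A' : extension P X) : Prop :=
  exists f : ext_space A -> ext_space A', homeomorphism f /\
    forall x, f (ext_map A x) = ext_map A' x.

(* order-isomorphism of the posets (E_P(X), <=) and (E_P(Y), <=) of
   extensions modulo ext_equiv, presented on representatives *)
Definition ext_order_isomorphic (P : Space -> Prop) (X Y : Space) : Prop :=
  exists F : extension P X -> extension P Y,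
    (forall A A', ext_equiv A A' <-> ext_equiv (F A) (F A')) /\
    (forall A A', ext_le A A' <-> ext_le (F A) (F A')) /\
    (forall B, exists A, ext_equiv (F A) B).

Definition lambda_P (P : Space -> Prop) (X B : Space) (e : X -> B) (p : B) : Prop :=
  exists C : X -> Prop, cozero C /\ P (subspace X (closure C)) /\
    interior (closure (image e C)) p.

(* Main.v *)
From Stdlib Require Import Reals List Classical ZArith Lra Lia.
From Stdlib Require Import ClassicalEpsilon FunctionalExtensionality
  PropExtensionality ProofIrrelevance.
Require Import Defs.

(** Write [C] for the compact set [beta X \ lambda_P X].  An extension of [X] with
    compact remainder and property [P] amounts to a closed partial equivalence
    relation on [beta X \ X] whose domain contains [C]: the domain is the preimage
    of the remainder and the classes are the fibres.  The order of extensions is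
    reverse inclusion of relations.  The least relation is equality on [C], and its
    covers either identify two points of [C] or add one point of [lambda_P X \ X];
    a cover is of the second kind iff some strictly larger relation contains no
    other cover.  Hence the order determines the two-element subsets of [C] and,
    since three of them form a triangle iff each is contained in every relation
    containing the other two, it determines the points of [C].  Finally a subset of
    [C] with at least two points is closed iff it is the only non-trivial class of
    a relation with domain [C]. *)

(** Why the domain contains [C]: near a point of [C] outside the domain, a closed piece of X would
    stay closed in the extension, inherit P from it and force the point into [lambda_P X]. Why every
    such relation gives an extension with P: the quotient map restricted to X together with the
    domain is perfect, so P depends on the domain alone. The whole domain may thus be collapsed to
    one point, and there condition (W) applies, since what lies outside a neighbourhood of that
    point is compact inside [lambda_P X]. The canonical map from beta X is defined over an extension
    only in part; it is treated as a closed relation between points, tested on pairs of real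
    functions. A single pair does not tell its two points apart. A point is therefore located as the
    common point of the images of all pairs through it, which takes at least three points; sets [C]
    with one or two points are handled separately. *)

Lemma choice {S T : Type} (Q : S -> T -> Prop) :
  (forall x, exists y, Q x y) -> exists f : S -> T, forall x, Q x (f x).
Proof.
  intro h; exists (fun x => proj1_sig (constructive_indefinite_description _ (h x))).
  intro x; apply proj2_sig.
Qed.

Lemma sig_eq {T : Type} {A : T -> Prop} (x y : {t | A t}) :
  proj1_sig x = proj1_sig y -> x = y.
Proof.
  destruct x as [x hx], y as [y hy]; simpl; intros ->.
  f_equal; apply proof_irrelevance.
Qed.

(** * Open, closed and compact sets *)

Lemma open_local {S : Space} (U : S -> Prop) :
  (forall x, U x -> exists V, is_open V /\ V x /\ forall y, V y -> U y) ->
  is_open U.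
Proof.
  intro H.
  apply (open_ext _ (fun x => exists V, (is_open V /\ forall y, V y -> U y) /\ V x)).
  - intro x; split.
    + intros [V [[_ h] hx]]; auto.
    + intro hx; destruct (H x hx) as [V [h1 [h2 h3]]]; eauto.
  - apply open_union; tauto.
Qed.

Lemma open_const (S : Space) (Q : Prop) : is_open (fun _ : S => Q).
Proof.
  apply open_local; intros x q; exists (fun _ => True).
  split; [apply open_full | auto].
Qed.

Lemma open_or {S : Space} (U V : S -> Prop) :
  is_open U -> is_open V -> is_open (fun x => U x \/ V x).
Proof.
  intros hU hV; apply open_local; intros x [h | h]; eauto.
Qed.

Lemma closed_compl {S : Space} (U : S -> Prop) :
  is_open U -> is_closed (fun x => ~ U x).
Proof. apply open_ext; intro x; split; [tauto | apply NNPP]. Qed.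

Lemma closed_and {S : Space} (A D : S -> Prop) :
  is_closed A -> is_closed D -> is_closed (fun x => A x /\ D x).
Proof.
  intros hA hD; apply (open_ext _ (fun x => ~ A x \/ ~ D x)).
  - intro x; tauto.
  - apply open_or; assumption.
Qed.

Lemma closed_or {S : Space} (A D : S -> Prop) :
  is_closed A -> is_closed D -> is_closed (fun x => A x \/ D x).
Proof.
  intros hA hD; apply (open_ext _ (fun x => ~ A x /\ ~ D x)).
  - intro x; tauto.
  - apply open_inter; assumption.
Qed.

Lemma closed_empty (S : Space) : is_closed (fun _ : S => False).
Proof. unfold is_closed; apply open_const. Qed.

Lemma closed_full (S : Space) : is_closed (fun _ : S => True).
Proof. unfold is_closed; apply open_const. Qed.

Lemma closed_of_closure {S : Space} (A : S -> Prop) :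
  (forall x, closure A x -> A x) -> is_closed A.
Proof.
  intro H; apply open_local; intros x hx.
  apply NNPP; intro h; apply hx, H; intros U hU hUx.
  apply NNPP; intro h'; apply h; exists U; split; [| split]; auto.
  intros y hy hA; apply h'; eauto.
Qed.

Lemma subset_closure {S : Space} (A : S -> Prop) x : A x -> closure A x.
Proof. intros h U _ hU; eauto. Qed.

Lemma closed_closure {S : Space} (A : S -> Prop) : is_closed (closure A).
Proof.
  apply closed_of_closure; intros x hx U hU hUx.
  destruct (hx U hU hUx) as [y [hy hA]]; exact (hA U hU hy).
Qed.

Lemma closure_min {S : Space} (A D : S -> Prop) :
  is_closed D -> (forall x, A x -> D x) -> forall x, closure A x -> D x.
Proof.
  intros hD hAD x hx; apply NNPP; intro h.
  destruct (hx _ hD h) as [y [h1 h2]]; auto.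
Qed.

Lemma closed_point {S : Space} (a : S) : hausdorff S -> is_closed (fun x => x = a).
Proof.
  intro hS; apply open_local; intros x hx.
  destruct (hS x a hx) as [U [V [hU [hV [hUx [hVa hd]]]]]].
  exists U; split; [| split]; auto; intros y hy ->; eauto.
Qed.

(** Most appeals to compactness pass through this principle: the open sets satisfying [Q] cover [A],
    and a finite subcover is merged by stability under unions. *)
Lemma compact_ind {S : Space} (A : S -> Prop) (Q : (S -> Prop) -> Prop) :
  compact_set A ->
  (forall U V, (forall x, U x -> V x) -> Q V -> Q U) ->
  Q (fun _ => False) ->
  (forall U V, Q U -> Q V -> Q (fun x => U x \/ V x)) ->
  (forall x, A x -> exists U, is_open U /\ U x /\ Q U) ->
  Q A.
Proof.
  intros hA hmono h0 hor hloc.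
  destruct (hA (fun U => is_open U /\ Q U)) as [l [hl hc]]; [tauto | |].
  - intros x hx; destruct (hloc x hx) as [U hU]; exists U; tauto.
  - apply hmono with (fun x => exists U, In U l /\ U x); [exact hc |].
    clear hc; induction l as [| U l IH].
    + apply hmono with (fun _ => False); [intros x [V [[] _]] | exact h0].
    + apply hmono with (fun x => U x \/ exists V, In V l /\ V x).
      * intros x [V [[-> | h] hx]]; eauto.
      * apply hor; [apply hl; left; reflexivity |].
        apply IH; intros V hV; apply hl; right; exact hV.
Qed.

Lemma compact_closed_subset {S : Space} (A D : S -> Prop) :
  compact_set A -> is_closed D -> (forall x, D x -> A x) -> compact_set D.
Proof.
  intros hA hD hDA F hF hc.
  apply (compact_ind A (fun W => exists l : list (S -> Prop),
     (forall U, In U l -> F U) /\ forall x, W x -> D x -> exists U, In U l /\ U x))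
    in hA.
  - destruct hA as [l [h1 h2]]; exists l; split; auto.
  - intros U V hUV [l [h1 h2]]; exists l; auto.
  - exists nil; split; [intros U [] | tauto].
  - intros U V [l [h1 h2]] [l' [h1' h2']]; exists (l ++ l')%list; split.
    + intros W hW; apply in_app_or in hW; destruct hW; auto.
    + intros x [h | h] hx.
      * destruct (h2 x h hx) as [W [hW hWx]]; exists W; split; auto.
        apply in_or_app; auto.
      * destruct (h2' x h hx) as [W [hW hWx]]; exists W; split; auto.
        apply in_or_app; auto.
  - intros x hx; destruct (classic (D x)) as [h | h].
    + destruct (hc x h) as [U [hU hUx]]; exists U; split; [| split]; auto.
      exists (U :: nil); split.
      * intros V [<- | []]; exact hU.
      * intros y hy _; exists U; simpl; auto.
    (* The complement of [D] contains nothing that has to be covered, hence the empty list. *)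
    + exists (fun y => ~ D y); split; [exact hD | split; [exact h |]].
      exists nil; split; [intros U [] | tauto].
Qed.

Lemma compact_image {S T : Space} (f : S -> T) (A : S -> Prop) (D : T -> Prop) :
  (forall V, is_open V -> forall x, A x -> V (f x) ->
     exists U, is_open U /\ U x /\ forall y, A y -> U y -> V (f y)) ->
  (forall t, D t -> exists x, A x /\ f x = t) -> (forall x, A x -> D (f x)) ->
  compact_set A -> compact_set D.
Proof.
  intros hf hs hi hA F hF hc.
  apply (compact_ind A (fun W => exists l : list (T -> Prop),
     (forall U, In U l -> F U) /\ forall x, A x -> W x -> exists U, In U l /\ U (f x)))
    in hA.
  - destruct hA as [l [h1 h2]]; exists l; split; auto.
    intros t ht; destruct (hs t ht) as [x [hx <-]]; auto.
  - intros U V hUV [l [h1 h2]]; exists l; auto.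
  - exists nil; split; [intros U [] | tauto].
  - intros U V [l [h1 h2]] [l' [h1' h2']]; exists (l ++ l')%list; split.
    + intros W hW; apply in_app_or in hW; destruct hW; auto.
    + intros x hx [h | h].
      * destruct (h2 x hx h) as [W [hW hWx]]; exists W; split; auto.
        apply in_or_app; auto.
      * destruct (h2' x hx h) as [W [hW hWx]]; exists W; split; auto.
        apply in_or_app; auto.
  - intros x hx; destruct (hc _ (hi x hx)) as [V [hV hVx]].
    destruct (hf V (hF V hV) x hx hVx) as [U [h1 [h2 h3]]].
    exists U; split; [| split]; auto.
    exists (V :: nil); split.
    + intros W [<- | []]; exact hV.
    + intros y hy hUy; exists V; simpl; auto.
Qed.

Lemma compact_subsingleton {S : Space} (A : S -> Prop) :
  (forall x y, A x -> A y -> x = y) -> compact_set A.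
Proof.
  intros hA F hF hc; destruct (classic (exists a, A a)) as [[a ha] | h].
  - destruct (hc a ha) as [U [hU hUa]]; exists (U :: nil); split.
    + intros V [<- | []]; exact hU.
    + intros x hx; exists U; rewrite (hA x a hx ha); simpl; auto.
  - exists nil; split; [intros U [] |].
    intros x hx; exfalso; eauto.
Qed.

Lemma compact_or {S : Space} (A D : S -> Prop) :
  compact_set A -> compact_set D -> compact_set (fun x => A x \/ D x).
Proof.
  intros hA hD F hF hc.
  destruct (hA F hF) as [l [h1 h2]]; [auto |].
  destruct (hD F hF) as [l' [h1' h2']]; [auto |].
  exists (l ++ l')%list; split.
  - intros W hW; apply in_app_or in hW; destruct hW; auto.
  - intros x [h | h].
    + destruct (h2 x h) as [W [hW hWx]]; exists W; split; auto.
      apply in_or_app; auto.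
    + destruct (h2' x h) as [W [hW hWx]]; exists W; split; auto.
      apply in_or_app; auto.
Qed.

Lemma compact_ext {S : Space} (A D : S -> Prop) :
  (forall x, A x <-> D x) -> compact_set A -> compact_set D.
Proof.
  intros h hA F hF hc; destruct (hA F hF) as [l [h1 h2]].
  - intros x hx; apply hc, h, hx.
  - exists l; split; auto; intros x hx; apply h2, h, hx.
Qed.

(** Tube lemma stated without product spaces: finitely many rectangles avoiding [D] cover [A], and
    their second sides are intersected. *)
Lemma tube {S T : Space} (A : S -> Prop) (D : S -> T -> Prop) (t : T) :
  compact_set A ->
  (forall s, A s -> exists U V, is_open U /\ is_open V /\ U s /\ V t /\
     forall s' t', U s' -> V t' -> ~ D s' t') ->
  exists V, is_open V /\ V t /\ forall s t', A s -> V t' -> ~ D s t'.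
Proof.
  intros hA h.
  apply (compact_ind A (fun W => exists V, is_open V /\ V t /\
    forall s t', W s -> V t' -> ~ D s t')) in hA; auto.
  - intros U V hUV [W [h1 [h2 h3]]]; exists W; split; [| split]; eauto.
  - exists (fun _ => True); split; [apply open_full | tauto].
  - intros U V [W [h1 [h2 h3]]] [W' [h1' [h2' h3']]].
    exists (fun t => W t /\ W' t); split; [apply open_inter; auto | split; auto].
    intros s t' [k | k] [k1 k2]; eauto.
  - intros s hs; destruct (h s hs) as [U [V [h1 [h2 [h3 [h4 h5]]]]]].
    exists U; split; [| split]; auto; exists V; auto.
Qed.

Lemma compact_is_closed {S : Space} (A : S -> Prop) :
  hausdorff S -> compact_set A -> is_closed A.
Proof.
  intros hS hA; apply open_local; intros x hx.
  destruct (tube A (fun s t => s = t) x hA) as [V [h1 [h2 h3]]].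
  - intros s hs; destruct (hS s x) as [U [V [k1 [k2 [k3 [k4 k5]]]]]].
    + intros ->; auto.
    + exists U, V; split; [| split; [| split; [| split]]]; auto.
      intros s' t' k6 k7 ->; eauto.
  - exists V; split; [| split]; auto; intros y hy hAy; apply (h3 y y); auto.
Qed.

Lemma closed_map_of_compact {S T : Space} (f : S -> T) :
  compact S -> hausdorff T -> continuous f -> closed_map f.
Proof.
  intros hS hT hf A hA; apply compact_is_closed; auto.
  apply (compact_image f A).
  - intros V hV x _ hx; exists (fun x => V (f x)); auto.
  - auto.
  - intros x hx; exists x; auto.
  - apply (compact_closed_subset (fun _ => True)); auto.
Qed.

Lemma normal_of_compact {S : Space} (A D : S -> Prop) :
  compact S -> hausdorff S -> is_closed A -> is_closed D ->
  (forall x, A x -> D x -> False) ->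
  exists U V, is_open U /\ is_open V /\ (forall x, A x -> U x) /\
    (forall x, D x -> V x) /\ forall x, U x -> V x -> False.
Proof.
  intros hS hH hA hD hd.
  assert (kA : compact_set A) by (apply (compact_closed_subset (fun _ => True)); auto).
  assert (kD : compact_set D) by (apply (compact_closed_subset (fun _ => True)); auto).
  assert (hp : forall x, D x -> exists U V, is_open U /\ is_open V /\
    (forall a, A a -> U a) /\ V x /\ forall y, U y -> V y -> False).
  { intros x hx.
    apply (compact_ind A (fun W => exists U V, is_open U /\ is_open V /\
      (forall a, W a -> U a) /\ V x /\ forall y, U y -> V y -> False)) in kA; auto.
    - intros W W' hW [U [V [h1 [h2 [h3 h4]]]]]; exists U, V; repeat split; auto; tauto.
    - exists (fun _ => False), (fun _ => True).
      split; [apply open_const | split; [apply open_const | tauto]].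
    - intros W W' [U [V [h1 [h2 [h3 [h4 h5]]]]]] [U' [V' [h1' [h2' [h3' [h4' h5']]]]]].
      exists (fun y => U y \/ U' y), (fun y => V y /\ V' y).
      split; [apply open_or; auto | split; [apply open_inter; auto |]].
      split; [intros a [k | k]; auto | split; [auto |]].
      intros y [k | k] [k1 k2]; eauto.
    - intros a ha; destruct (hH a x) as [U [V [h1 [h2 [h3 [h4 h5]]]]]].
      + intros ->; eauto.
      + exists U; split; [| split]; auto; exists U, V; auto. }
  apply (compact_ind D (fun W => exists U V, is_open U /\ is_open V /\
      (forall a, A a -> U a) /\ (forall a, W a -> V a) /\
      forall y, U y -> V y -> False)) in kD; auto.
  - intros W W' hW [U [V [h1 [h2 [h3 [h4 h5]]]]]]; exists U, V; repeat split; auto; tauto.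
  - exists (fun _ => True), (fun _ => False).
    split; [apply open_const | split; [apply open_const | tauto]].
  - intros W W' [U [V [h1 [h2 [h3 [h4 h5]]]]]] [U' [V' [h1' [h2' [h3' [h4' h5']]]]]].
    exists (fun y => U y /\ U' y), (fun y => V y \/ V' y).
    split; [apply open_inter; auto | split; [apply open_or; auto |]].
    split; [auto | split; [intros a [k | k]; auto |]].
    intros y [k1 k2] [k | k]; eauto.
  - intros x hx; destruct (hp x hx) as [U [V [h1 [h2 [h3 [h4 h5]]]]]].
    exists V; split; [| split]; auto; exists U, V; auto.
Qed.

(** * Real-valued continuous functions *)

Lemma rcontinuous_iff {S : Space} (f : S -> R) :
  rcontinuous f <-> forall x eps, (0 < eps)%R ->
    exists U, is_open U /\ U x /\ forall y, U y -> (Rabs (f y - f x) < eps)%R.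
Proof.
  split.
  - intros hf x eps he.
    exists (fun y => (f x - eps < f y < f x + eps)%R).
    split; [apply hf | split; [lra |]].
    intros y hy; apply Rabs_def1; lra.
  - intros H a b; apply open_local; intros x hx.
    destruct (H x (Rmin (f x - a) (b - f x))) as [U [h1 [h2 h3]]].
    + apply Rmin_pos; lra.
    + exists U; split; [| split]; auto; intros y hy.
      generalize (h3 y hy) (Rmin_l (f x - a) (b - f x)) (Rmin_r (f x - a) (b - f x)).
      intros k k1 k2; apply Rabs_def2 in k; lra.
Qed.

Lemma rcontinuous_lipschitz {S : Space} (f : S -> R) (phi : R -> R) (c : R) :
  (0 < c)%R -> (forall a b, Rabs (phi a - phi b) <= c * Rabs (a - b))%R ->
  rcontinuous f -> rcontinuous (fun x => phi (f x)).
Proof.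
  intros hc hphi hf; apply rcontinuous_iff; intros x eps he.
  destruct (proj1 (rcontinuous_iff f) hf x (eps / c)%R) as [U [h1 [h2 h3]]].
  - apply Rdiv_lt_0_compat; auto.
  - exists U; split; [| split]; auto; intros y hy.
    apply Rle_lt_trans with (1 := hphi _ _).
    apply Rlt_le_trans with (c * (eps / c))%R.
    + apply Rmult_lt_compat_l; auto.
    + right; field; lra.
Qed.

Lemma rcontinuous_comp {S T : Space} (f : S -> T) (h : T -> R) :
  continuous f -> rcontinuous h -> rcontinuous (fun x => h (f x)).
Proof. intros hf hh a b; exact (hf _ (hh a b)). Qed.

Lemma open_lt {S : Space} (f : S -> R) (c : R) :
  rcontinuous f -> is_open (fun x => (f x < c)%R).
Proof.
  intro hf; apply open_local; intros x hx.
  exists (fun y => (f x - 1 < f y < c)%R); split; [apply hf | split; [lra |]].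
  intros; lra.
Qed.

Lemma open_gt {S : Space} (f : S -> R) (c : R) :
  rcontinuous f -> is_open (fun x => (c < f x)%R).
Proof.
  intro hf; apply open_local; intros x hx.
  exists (fun y => (c < f y < f x + 1)%R); split; [apply hf | split; [lra |]].
  intros; lra.
Qed.

Lemma rcontinuous_neq {S : Space} (f : S -> R) (x : S) (c : R) :
  rcontinuous f -> f x <> c ->
  exists U eps, is_open U /\ U x /\ (0 < eps)%R /\
    forall y, U y -> (Rabs (f y - c) > eps)%R.
Proof.
  intros hf hx.
  assert (h0 : (0 < Rabs (f x - c))%R) by (apply Rabs_pos_lt; lra).
  destruct (proj1 (rcontinuous_iff f) hf x (Rabs (f x - c) / 2)%R) as [U [h1 [h2 h3]]];
    [lra |].
  exists U, (Rabs (f x - c) / 2)%R; split; [| split; [| split]]; auto; [lra |].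
  intros y hy; specialize (h3 y hy).
  generalize (Rabs_triang (f x - f y) (f y - c)).
  replace (f x - f y + (f y - c))%R with (f x - c)%R by ring.
  rewrite (Rabs_minus_sym (f x) (f y)); lra.
Qed.

(** * Urysohn's lemma *)

(** Stands for: the closure of [U] lies in [V]. A closed set in between is what normality consumes
    and produces. *)
Definition well_inside {S : Space} (U V : S -> Prop) : Prop :=
  exists W, is_closed W /\ (forall x, U x -> W x) /\ forall x, W x -> V x.

Section Urysohn.

Variable S : Space.
Hypotheses (hS : compact S) (hH : hausdorff S).

Lemma interpolate (U V : S -> Prop) :
  is_open V -> well_inside U V ->
  exists O, is_open O /\ well_inside U O /\ well_inside O V.
Proof.
  intros hV [W [hW [h1 h2]]].
  destruct (normal_of_compact W (fun x => ~ V x) hS hH hW) as [O [O' [k1 [k2 [k3 [k4 k5]]]]]].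
  - apply closed_compl; auto.
  - intros x hx h; auto.
  - exists O; split; [auto | split].
    + exists W; auto.
    + exists (fun x => ~ O' x); split; [apply closed_compl; auto | split].
      * intros x hx h; eauto.
      * intros x hx; apply NNPP; intro h; auto.
Qed.

(** [epsilon] makes the choice total, so that [dyadic] can be a plain recursion; the value is
    meaningful only for [U] well inside an open [V]. *)
Definition between (U V : S -> Prop) : S -> Prop :=
  epsilon (inhabits U) (fun O => is_open O /\ well_inside U O /\ well_inside O V).

Lemma between_spec (U V : S -> Prop) :
  is_open V -> well_inside U V ->
  is_open (between U V) /\ well_inside U (between U V) /\ well_inside (between U V) V.
Proof. intros hV h; exact (epsilon_spec (inhabits U) _ (interpolate U V hV h)). Qed.

Variables (U0 U1 : S -> Prop).
Hypotheses (oU0 : is_open U0) (oU1 : is_open U1) (h01 : well_inside U0 U1).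

(* [dyadic n k] is the open set attached to the dyadic number [k / 2 ^ n]. *)
Fixpoint dyadic (n k : nat) : S -> Prop :=
  match n with
  | O => match k with O => U0 | _ => U1 end
  | Datatypes.S n => if Nat.even k then dyadic n (Nat.div2 k)
      else between (dyadic n (Nat.div2 k)) (dyadic n (Datatypes.S (Nat.div2 k)))
  end.

Lemma dyadic_even n k : dyadic (1 + n) (2 * k) = dyadic n k.
Proof.
  change (dyadic (1 + n) (2 * k)) with (if Nat.even (2 * k)
    then dyadic n (Nat.div2 (2 * k)) else
    between (dyadic n (Nat.div2 (2 * k))) (dyadic n (Datatypes.S (Nat.div2 (2 * k))))).
  rewrite Nat.even_mul, Nat.div2_double; reflexivity.
Qed.

Lemma dyadic_odd n k :
  dyadic (1 + n) (1 + 2 * k) = between (dyadic n k) (dyadic n (1 + k)).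
Proof.
  change (dyadic (1 + n) (1 + 2 * k)) with (if Nat.even (1 + 2 * k)
    then dyadic n (Nat.div2 (1 + 2 * k)) else
    between (dyadic n (Nat.div2 (1 + 2 * k)))
      (dyadic n (Datatypes.S (Nat.div2 (1 + 2 * k))))).
  rewrite Nat.even_add_mul_2; change (1 + 2 * k)%nat with (Datatypes.S (2 * k)).
  rewrite Nat.div2_succ_double; reflexivity.
Qed.

Lemma dyadic_spec n : (forall k, k <= 2 ^ n -> is_open (dyadic n k))%nat /\
  (forall k, k < 2 ^ n -> well_inside (dyadic n k) (dyadic n (1 + k)))%nat.
Proof.
  induction n as [| n [IHo IHi]].
  - split.
    + intros [| k] _; simpl; auto.
    + intros [| k] hk; simpl in *; [auto | lia].
  - rewrite Nat.pow_succ_r'; split; intros k hk;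
      destruct (Nat.Even_or_Odd k) as [[j ->] | [j ->]].
    + change (Datatypes.S n) with (1 + n)%nat; rewrite dyadic_even; apply IHo; lia.
    + rewrite Nat.add_comm; change (Datatypes.S n) with (1 + n)%nat; rewrite dyadic_odd.
      apply between_spec; [apply IHo | apply IHi]; lia.
    + change (Datatypes.S n) with (1 + n)%nat; rewrite dyadic_even, dyadic_odd.
      apply between_spec; [apply IHo | apply IHi]; lia.
    + replace (1 + (2 * j + 1))%nat with (2 * (1 + j))%nat by lia.
      rewrite (Nat.add_comm (2 * j)); change (Datatypes.S n) with (1 + n)%nat.
      rewrite dyadic_even, dyadic_odd.
      apply between_spec; [apply IHo | apply IHi]; lia.
Qed.

Lemma dyadic_mono n j k x : (j <= k <= 2 ^ n)%nat -> dyadic n j x -> dyadic n k x.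
Proof.
  intros [hjk hk] hx; induction hjk as [| k hjk IH]; auto.
  destruct (proj2 (dyadic_spec n) k) as [W [_ [h1 h2]]]; [lia |].
  apply h2, h1, IH; lia.
Qed.

Lemma dyadic_refine n m k : dyadic (m + n) (2 ^ m * k) = dyadic n k.
Proof.
  induction m as [| m IH]; [simpl; f_equal; lia |].
  rewrite Nat.pow_succ_r', <- Nat.mul_assoc.
  change (Datatypes.S m + n)%nat with (1 + (m + n))%nat.
  rewrite dyadic_even; exact IH.
Qed.

Lemma pow2_INR n : INR (2 ^ n) = (2 ^ n)%R.
Proof. rewrite pow_INR; reflexivity. Qed.

Lemma pow2_pos n : (0 < 2 ^ n)%R.
Proof. apply pow_lt; lra. Qed.

(** Contrapositive of monotonicity, after passing to the common denominator [2 ^ (m + n)]. *)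
Lemma dyadic_lt n k m j x : (k <= 2 ^ n)%nat -> (j <= 2 ^ m)%nat ->
  dyadic n k x -> ~ dyadic m j x -> (INR j / 2 ^ m < INR k / 2 ^ n)%R.
Proof.
  intros hk hj h1 h2.
  assert (h : (2 ^ n * j < 2 ^ m * k)%nat).
  { apply Nat.nle_gt; intro h; apply h2.
    rewrite <- (dyadic_refine m n j), Nat.add_comm.
    apply dyadic_mono with (2 ^ m * k)%nat; [| rewrite dyadic_refine; exact h1].
    split; [lia |]; rewrite Nat.pow_add_r; nia. }
  apply lt_INR in h; rewrite !mult_INR, !pow2_INR in h.
  generalize (pow2_pos n) (pow2_pos m); intros p1 p2.
  apply Rmult_lt_reg_r with (2 ^ n * 2 ^ m)%R; [nra |].
  replace (INR j / 2 ^ m * (2 ^ n * 2 ^ m))%R with (2 ^ n * INR j)%R by (field; lra).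
  replace (INR k / 2 ^ n * (2 ^ n * 2 ^ m))%R with (2 ^ m * INR k)%R by (field; lra).
  exact h.
Qed.

(** The Urysohn function at [x] is the supremum of these values. The value 0 is thrown in so that
    there is one even when [x] lies in all the dyadic sets. *)
Definition level (x : S) (r : R) : Prop :=
  r = 0%R \/ exists n k, (k <= 2 ^ n)%nat /\ ~ dyadic n k x /\ r = (INR k / 2 ^ n)%R.

Lemma level_le_1 x r : level x r -> (r <= 1)%R.
Proof.
  intros [-> | [n [k [hk [_ ->]]]]]; [lra |].
  apply le_INR in hk; rewrite pow2_INR in hk; generalize (pow2_pos n); intro.
  apply Rmult_le_reg_r with (2 ^ n)%R; auto.
  unfold Rdiv; rewrite Rmult_assoc, Rinv_l; lra.
Qed.

Lemma small_pow2 (eps : R) : (0 < eps)%R -> exists n, (1 / 2 ^ n < eps)%R.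
Proof.
  intro he; destruct (pow_lt_1_zero (1 / 2)) with (y := eps) as [n hn]; auto.
  - rewrite Rabs_pos_eq; lra.
  - exists n; specialize (hn n (le_n n)).
    apply Rabs_def2 in hn; destruct hn as [hn _].
    unfold Rdiv in *; rewrite Rmult_1_l in *; rewrite pow_inv in hn; exact hn.
Qed.

Lemma urysohn_levels : exists f : S -> R, rcontinuous f /\
  (forall z, (0 <= f z <= 1)%R) /\ (forall z, U0 z -> f z = 0%R) /\
  (forall z, ~ U1 z -> f z = 1%R).
Proof.
  assert (hf : forall x, exists m, is_lub (level x) m).
  { intro x; destruct (completeness (level x)) as [m hm]; eauto.
    - exists 1%R; exact (level_le_1 x).
    - exists 0%R; left; reflexivity. }
  apply choice in hf; destruct hf as [f hf]; exists f.
  assert (ub : forall x r, level x r -> (r <= f x)%R) by (intros x; apply (hf x)).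
  assert (lb : forall x b, (forall r, level x r -> r <= b)%R -> (f x <= b)%R)
    by (intros x; apply (hf x)).
  assert (f0 : forall x, (0 <= f x)%R) by (intro x; apply ub; left; reflexivity).
  assert (f1 : forall x, (f x <= 1)%R) by (intro x; apply lb, level_le_1).
  split; [| split; [| split]].
  - assert (hlt : forall b, is_open (fun x => (f x < b)%R)).
    { intro b; apply open_local; intros x hx.
      destruct (Rlt_le_dec 1 b) as [hb | hb].
      - exists (fun _ => True); split; [apply open_full | split; auto].
        intros y _; specialize (f1 y); lra.
      - destruct (small_pow2 (b - f x)) as [n hn]; [lra |].
        generalize (pow2_pos n); intro p.
        (* [up] returns the least integer above [f x * 2 ^ n], so [k / 2 ^ n] exceeds [f x] by at
           most [1 / 2 ^ n] and stays below [b]; [dyadic n k] is the neighbourhood sought. *)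
        destruct (archimed (f x * 2 ^ n)) as [a1 a2].
        assert (a0 : (0 < up (f x * 2 ^ n))%Z).
        { apply lt_IZR; specialize (f0 x); nra. }
        set (k := Z.to_nat (up (f x * 2 ^ n))).
        assert (hk : INR k = IZR (up (f x * 2 ^ n))).
        { unfold k; rewrite INR_IZR_INZ, Z2Nat.id; auto; lia. }
        assert (k1 : (f x < INR k / 2 ^ n)%R).
        { apply Rmult_lt_reg_r with (2 ^ n)%R; auto.
          unfold Rdiv; rewrite Rmult_assoc, Rinv_l; lra. }
        assert (k2 : (INR k / 2 ^ n < b)%R).
        { apply Rle_lt_trans with (f x + 1 / 2 ^ n)%R; [| lra].
          apply Rmult_le_reg_r with (2 ^ n)%R; auto.
          replace ((f x + 1 / 2 ^ n) * 2 ^ n)%R with (f x * 2 ^ n + 1)%R by (field; lra).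
          unfold Rdiv; rewrite Rmult_assoc, Rinv_l; lra. }
        assert (k3 : (k <= 2 ^ n)%nat).
        { apply INR_le; rewrite pow2_INR.
          apply Rmult_le_reg_r with (/ 2 ^ n)%R; [apply Rinv_0_lt_compat; auto |].
          rewrite Rinv_r; [unfold Rdiv in k2; lra | lra]. }
        exists (dyadic n k); split; [apply dyadic_spec; auto | split].
        + apply NNPP; intro h; apply (Rlt_not_le _ _ k1), ub; right; exists n, k; auto.
        + intros y hy; apply Rle_lt_trans with (2 := k2), lb.
          intros r [-> | [m [j [hj [hd ->]]]]].
          * specialize (f0 x); lra.
          * left; apply dyadic_lt with y; auto. }
    assert (hgt : forall a, is_open (fun x => (a < f x)%R)).
    { intro a; apply open_local; intros x hx.
      destruct (Rlt_le_dec a 0) as [ha | ha].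
      - exists (fun _ => True); split; [apply open_full | split; auto].
        intros y _; specialize (f0 y); lra.
      - assert (hr : exists r, level x r /\ (a < r)%R).
        { apply NNPP; intro h; apply (Rlt_not_le _ _ hx), lb; intros r hr.
          apply Rnot_lt_le; intro; apply h; eauto. }
        destruct hr as [r [[-> | [n [k [hk [hd ->]]]]] har]]; [lra |].
        destruct (small_pow2 (INR k / 2 ^ n - a)) as [m hm]; [lra |].
        generalize (pow2_pos n) (pow2_pos m); intros p1 p2.
        assert (k0 : (0 < k)%nat).
        { destruct k; [| lia]; simpl in har; unfold Rdiv in har; lra. }
        assert (q : (1 <= 2 ^ m)%nat) by (generalize (Nat.pow_nonzero 2 m); lia).
        assert (q' : (1 <= 2 ^ n)%nat) by (generalize (Nat.pow_nonzero 2 n); lia).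
        (* [j / 2 ^ (m + n)] is the predecessor of [k / 2 ^ n] at the finer level and still exceeds
           [a]. A closed set lies between the two dyadic sets; its complement is a neighbourhood of
           [x] missing the smaller one. *)
        set (j := (2 ^ m * k - 1)%nat).
        assert (hj : (1 + j = 2 ^ m * k)%nat) by (unfold j; nia).
        assert (hj' : (1 + j <= 2 ^ (m + n))%nat).
        { rewrite hj, Nat.pow_add_r; nia. }
        destruct (proj2 (dyadic_spec (m + n)) j) as [W [hW [w1 w2]]]; [lia |].
        rewrite hj, dyadic_refine in w2.
        exists (fun y => ~ W y); split; [exact hW | split; [auto |]].
        intros y hy.
        apply Rlt_le_trans with (INR j / 2 ^ (m + n))%R.
        + rewrite pow_add.
          assert (e : (INR j = 2 ^ m * INR k - 1)%R).
          { apply (f_equal INR) in hj; rewrite plus_INR, mult_INR, pow2_INR in hj.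
            simpl in hj; lra. }
          rewrite e.
          apply Rle_lt_trans with (INR k / 2 ^ n - (INR k / 2 ^ n - a))%R; [lra |].
          apply Rlt_le_trans with (INR k / 2 ^ n - 1 / 2 ^ m)%R; [lra |].
          replace ((2 ^ m * INR k - 1) / (2 ^ m * 2 ^ n))%R
            with (INR k / 2 ^ n - 1 / 2 ^ m * (1 / 2 ^ n))%R by (field; lra).
          assert (i1 : (1 / 2 ^ n <= 1)%R).
          { apply le_INR in q'; rewrite pow2_INR in q'; simpl in q'.
            apply Rmult_le_reg_r with (2 ^ n)%R; auto.
            unfold Rdiv; rewrite Rmult_assoc, Rinv_l; lra. }
          assert (i2 : (0 < 1 / 2 ^ m)%R) by (apply Rdiv_lt_0_compat; lra).
          nra.
        + apply ub; right; exists (m + n)%nat, j; split; [lia | split; auto]. }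
    intros a b; apply open_inter; auto.
  - auto.
  - intros z hz; apply Rle_antisym; auto; apply lb.
    intros r [-> | [n [k [hk [hd ->]]]]]; [lra |].
    exfalso; apply hd, dyadic_mono with (0 * 2 ^ n)%nat; [lia |].
    rewrite Nat.mul_comm, <- (Nat.add_0_r n) at 1; rewrite dyadic_refine; exact hz.
  - intros z hz; apply Rle_antisym; auto; apply ub; right.
    exists 0%nat, 1%nat; simpl; split; [lia | split; [exact hz | lra]].
Qed.

End Urysohn.

Lemma tychonoff_of_compact (S : Space) : compact S -> hausdorff S -> tychonoff S.
Proof.
  intros hS hH; split; auto; intros A x hA hx.
  (* [urysohn_levels] starts from an open set, so an open [O] is first put between the point and the
     complement of [A]. *)
  destruct (interpolate S hS hH (fun z => z = x) (fun z => ~ A z)) as [O [hO [[W [_ [h1 h2]]] h3]]].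
  - exact hA.
  - exists (fun z => z = x); split; [apply closed_point; auto | split; auto].
    intros z ->; auto.
  - destruct (urysohn_levels S hS hH O (fun z => ~ A z) hO hA h3) as [f [f1 [f2 [f3 f4]]]].
    exists f; split; [auto | split; [auto | split]]; auto.
Qed.

(** * Subspaces, embeddings and perfect maps *)

Lemma hausdorff_subspace (S : Space) (A : S -> Prop) :
  hausdorff S -> hausdorff (subspace S A).
Proof.
  intros hS x y hxy.
  destruct (hS (proj1_sig x) (proj1_sig y)) as [U [V [h1 [h2 [h3 [h4 h5]]]]]].
  - intro h; apply hxy, sig_eq, h.
  - exists (fun z => U (proj1_sig z)), (fun z => V (proj1_sig z)).
    split; [exists U; split; [auto | tauto] |].
    split; [exists V; split; [auto | tauto] |].
    split; [exact h3 | split; [exact h4 | intros z; apply h5]].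
Qed.

Lemma continuous_proj1 (S : Space) (A : S -> Prop) :
  @continuous (subspace S A) S (@proj1_sig S A).
Proof. intros V hV; exists V; split; [auto | tauto]. Qed.

Lemma embedding_proj1 (S : Space) (A : S -> Prop) :
  @embedding (subspace S A) S (@proj1_sig S A).
Proof.
  split; [apply continuous_proj1 | split; [intros x y; apply sig_eq |]].
  intros U [V [hV h]]; exists V; auto.
Qed.

Lemma tychonoff_subspace (S : Space) (A : S -> Prop) :
  tychonoff S -> tychonoff (subspace S A).
Proof.
  intros [hH hC]; split; [apply hausdorff_subspace; auto |].
  intros D x [U [hU h]] hx.
  destruct (hC (fun y => ~ U y) (proj1_sig x)) as [f [f1 [f2 [f3 f4]]]].
  - apply closed_compl; auto.
  - intro k; apply k, h, hx.
  - exists (fun z => f (proj1_sig z)).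
    split; [exact (rcontinuous_comp _ _ (continuous_proj1 S A) f1) |].
    split; [intro z; apply f2 | split; [exact f3 |]].
    intros z hz; apply f4; rewrite <- h; tauto.
Qed.

Lemma continuous_into_subspace {S T : Space} (A : T -> Prop) (f : S -> subspace T A) :
  continuous (fun x => proj1_sig (f x)) -> continuous f.
Proof.
  intros hf V [W [hW h]].
  apply (open_ext _ (fun x => W (proj1_sig (f x)))); [intro x; symmetry; apply h |].
  apply (hf W hW).
Qed.

Lemma compact_subspace {S : Space} (A D : S -> Prop) :
  compact_set D -> (forall x, D x -> A x) ->
  @compact_set (subspace S A) (fun x => D (proj1_sig x)).
Proof.
  intros hD hDA F hF hc.
  destruct (hD (fun U => is_open U /\ exists V, F V /\ forall x, V x <-> U (proj1_sig x)))
    as [l [h1 h2]]; [tauto | |].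
  - intros x hx; destruct (hc (exist _ x (hDA x hx)) hx) as [V [hV hVx]].
    destruct (hF V hV) as [U [hU hUV]].
    exists U; split; [split; eauto |]; exact (proj1 (hUV _) hVx).
  - assert (hl : exists l' : list (subspace S A -> Prop), (forall V, In V l' -> F V) /\
      forall x : subspace S A, (exists U, In U l /\ U (proj1_sig x)) ->
        exists V, In V l' /\ V x).
    { clear h2; induction l as [| U l IH].
      - exists nil; split; [intros V [] | intros x [U [[] _]]].
      - destruct IH as [l' [k1 k2]]; [intros V hV; apply h1; right; auto |].
        destruct (h1 U (or_introl eq_refl)) as [_ [V [hV hUV]]].
        exists (V :: l'); split.
        + intros W [<- | hW]; auto.
        + intros x [W [[<- | hW] hWx]].
          * exists V; split; [left; auto | apply hUV; auto].
          * destruct (k2 x) as [V' [m1 m2]]; [eauto |].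
            exists V'; split; [right; auto | auto]. }
    destruct hl as [l' [k1 k2]]; exists l'; split; auto.
Qed.

Lemma closed_subspace (S : Space) (A D : S -> Prop) :
  is_closed D -> @is_closed (subspace S A) (fun x => D (proj1_sig x)).
Proof. intro hD; exists (fun x => ~ D x); split; [exact hD | tauto]. Qed.

Lemma closed_map_proj1 (S : Space) (A : S -> Prop) :
  is_closed A -> @closed_map (subspace S A) S (@proj1_sig S A).
Proof.
  intros hA D [U [hU h]].
  apply (open_ext _ (fun x => ~ A x \/ U x)).
  - intro x; split.
    + intros [k | k] [[y hy] [h1 h2]]; simpl in h2; subst y; [auto |].
      apply (proj2 (h (exist _ x hy))) in k; auto.
    + intro k; destruct (classic (A x)) as [hx | hx]; [right | left; auto].
      apply (h (exist _ x hx)); intro h'; apply k; exists (exist _ x hx); auto.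
  - apply open_or; auto.
Qed.

(** [P] is assumed invariant only under perfect surjections; its invariance under homeomorphisms is
    obtained through this lemma. *)
Lemma embedding_surj_perfect {S T : Space} (f : S -> T) :
  embedding f -> (forall y, exists x, f x = y) -> perfect_surjection f.
Proof.
  intros [hc [hi ho]] hs; split; [auto | split; [| split; [auto |]]].
  - intros A hA; destruct (ho _ hA) as [V [hV h]].
    apply (open_ext _ V); auto; intro y; destruct (hs y) as [x <-].
    rewrite <- h; split.
    + intros k [z [h1 h2]]; apply hi in h2; subst; auto.
    + intros k h1; apply k; exists x; auto.
  - intro y; apply compact_subsingleton; intros a b ha hb; apply hi; congruence.
Qed.

(** * Disjoint sums of two spaces *)

Definition sum_open (S T : Space) (U : S + T -> Prop) : Prop :=
  is_open (fun x => U (inl x)) /\ is_open (fun x => U (inr x)).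

Definition sum_space (S T : Space) : Space.
Proof.
  refine {| carrier := (S + T)%type; is_open := sum_open S T |}.
  - intros U V h [h1 h2]; split.
    + exact (open_ext _ _ _ (fun x => h (inl x)) h1).
    + exact (open_ext _ _ _ (fun x => h (inr x)) h2).
  - split; apply open_full.
  - intros U V [h1 h2] [h3 h4]; split.
    + exact (open_inter _ _ _ h1 h3).
    + exact (open_inter _ _ _ h2 h4).
  - intros F hF; split; apply open_local; intros x [U [hU hUx]].
    + exists (fun x => U (inl x)); split; [apply hF; auto | split; eauto].
    + exists (fun x => U (inr x)); split; [apply hF; auto | split; eauto].
Defined.

Definition is_left {S T : Type} (z : S + T) : Prop :=
  match z with inl _ => True | inr _ => False end.

Lemma open_left (S T : Space) : @is_open (sum_space S T) is_left.
Proof. split; simpl; apply open_const. Qed.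

Lemma open_right (S T : Space) : @is_open (sum_space S T) (fun z => ~ is_left z).
Proof. split; simpl; apply open_const. Qed.

Lemma tychonoff_sum (S T : Space) :
  tychonoff S -> tychonoff T -> tychonoff (sum_space S T).
Proof.
  intros [hS cS] [hT cT]; split.
  - intros [x | x] [y | y] hxy.
    + destruct (hS x y) as [U [V [h1 [h2 [h3 [h4 h5]]]]]]; [congruence |].
      exists (fun z => match z with inl z => U z | _ => False end),
        (fun z => match z with inl z => V z | _ => False end).
      split; [split; auto; simpl; apply open_const |].
      split; [split; auto; simpl; apply open_const |].
      split; [auto | split; [auto |]]; intros [z | z]; simpl; solve [apply h5 | tauto].
    + exists is_left, (fun z => ~ is_left z); split; [apply open_left |].
      split; [apply open_right |]; simpl; tauto.
    + exists (fun z => ~ is_left z), is_left; split; [apply open_right |].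
      split; [apply open_left |]; simpl; tauto.
    + destruct (hT x y) as [U [V [h1 [h2 [h3 [h4 h5]]]]]]; [congruence |].
      exists (fun z => match z with inr z => U z | _ => False end),
        (fun z => match z with inr z => V z | _ => False end).
      split; [split; auto; simpl; apply open_const |].
      split; [split; auto; simpl; apply open_const |].
      split; [auto | split; [auto |]]; intros [z | z]; simpl; solve [apply h5 | tauto].
  - intros A [x | x] [hA1 hA2] hx.
    + destruct (cS (fun z => A (inl z)) x) as [f [f1 [f2 [f3 f4]]]]; auto.
      exists (fun z => match z with inl z => f z | inr _ => 1%R end).
      split; [intros a b; split; [exact (f1 a b) | simpl; apply open_const] |].
      split; [intros [z | z]; auto; lra | split; auto].
      intros [z | z]; auto.
    + destruct (cT (fun z => A (inr z)) x) as [f [f1 [f2 [f3 f4]]]]; auto.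
      exists (fun z => match z with inr z => f z | inl _ => 1%R end).
      split; [intros a b; split; [simpl; apply open_const | exact (f1 a b)] |].
      split; [intros [z | z]; auto; lra | split; auto].
      intros [z | z]; auto.
Qed.

Definition sum_elim {S T W : Type} (f : S -> W) (g : T -> W) (z : S + T) : W :=
  match z with inl x => f x | inr y => g y end.

Lemma sum_elim_perfect {S T W : Space} (f : S -> W) (g : T -> W) :
  embedding f -> embedding g -> closed_map f -> closed_map g ->
  (forall w, (exists x, f x = w) \/ exists y, g y = w) ->
  @perfect_surjection (sum_space S T) W (sum_elim f g).
Proof.
  intros [fc [fi _]] [gc [gi _]] fcl gcl hs; split; [| split; [| split]].
  - intros V hV; split; [apply fc | apply gc]; auto.
  - intros A [hA1 hA2].
    apply (open_ext _ (fun w => ~ (image f (fun x => A (inl x)) w \/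
      image g (fun x => A (inr x)) w))).
    + intro w; split; intros h k; apply h.
      * destruct k as [[x | x] [k1 k2]]; [left | right]; exists x; auto.
      * destruct k as [[x [k1 k2]] | [x [k1 k2]]]; [exists (inl x) | exists (inr x)]; auto.
    + apply closed_or; auto.
  - intro w; destruct (hs w) as [[x h] | [x h]]; [exists (inl x) | exists (inr x)]; auto.
  - intro w.
    (* A fibre has at most one point in each summand. *)
    apply compact_ext with (fun z : sum_space S T => (is_left z /\ sum_elim f g z = w) \/
      (~ is_left z /\ sum_elim f g z = w)); [intro z; tauto |].
    apply compact_or; apply compact_subsingleton.
    + intros [x | x] [y | y] [h1 h2] [h3 h4]; simpl in *; try tauto.
      f_equal; apply fi; congruence.
    + intros [x | x] [y | y] [h1 h2] [h3 h4]; simpl in *; try tauto.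
      f_equal; apply gi; congruence.
Qed.

Lemma embedding_inl (S T : Space) : @embedding S (sum_space S T) inl.
Proof.
  split; [intros V [h _]; exact h | split; [congruence |]].
  intros U hU; exists (fun z => match z with inl z => U z | _ => False end).
  split; [split; [exact hU | simpl; apply open_const] | tauto].
Qed.

Lemma embedding_inr (S T : Space) : @embedding T (sum_space S T) inr.
Proof.
  split; [intros V [_ h]; exact h | split; [congruence |]].
  intros U hU; exists (fun z => match z with inr z => U z | _ => False end).
  split; [split; [simpl; apply open_const | exact hU] | tauto].
Qed.

(** * Compactness-like properties *)

Section CompactnessLike.

Variable P : Space -> Prop.
Hypothesis HP : compactness_like P.

Lemma P_perfect {Z W : Space} (f : Z -> W) :
  tychonoff Z -> tychonoff W -> perfect_surjection f -> (P Z <-> P W).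
Proof. destruct HP as [_ [_ [h _]]]; apply h. Qed.

(** An embedding restricts to a homeomorphism of [A] onto its image. The image is given by a
    pointwise equivalence so that any predicate describing it can be used. *)
Lemma P_embedding {S T : Space} (i : S -> T) (A : S -> Prop) (D : T -> Prop) :
  tychonoff S -> tychonoff T -> embedding i ->
  (forall t, D t <-> exists s, A s /\ i s = t) ->
  (P (subspace S A) <-> P (subspace T D)).
Proof.
  intros hS hT [ic [ii io]] hD.
  assert (hi : forall x : subspace S A, D (i (proj1_sig x))).
  { intros [x hx]; apply hD; eauto. }
  apply (P_perfect (fun x : subspace S A => exist D (i (proj1_sig x)) (hi x) : subspace T D)).
  - apply tychonoff_subspace; auto.
  - apply tychonoff_subspace; auto.
  - apply embedding_surj_perfect; [split; [| split] |].
    + apply continuous_into_subspace; simpl; intros V hV.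
      exists (fun x => V (i x)); split; [apply ic; auto | tauto].
    + intros x y h; apply sig_eq, ii; exact (f_equal (@proj1_sig _ _) h).
    + intros U [V [hV h]]; destruct (io V hV) as [W [hW hVW]].
      exists (fun x => W (proj1_sig x)); split; [exists W; split; [auto | tauto] |].
      intro x; rewrite h, hVW; reflexivity.
    + intros [t ht]; destruct (proj1 (hD t) ht) as [s [hs e]].
      exists (exist _ s hs); apply sig_eq; exact e.
Qed.

Lemma P_subspace_full (Z : Space) (A : Z -> Prop) :
  tychonoff Z -> (forall z, A z) -> (P (subspace Z A) <-> P Z).
Proof.
  intros hZ hA; apply (P_perfect (@proj1_sig Z A : subspace Z A -> Z)); auto.
  - apply tychonoff_subspace; auto.
  - apply embedding_surj_perfect; [apply embedding_proj1 |].
    intro z; exists (exist _ z (hA z)); reflexivity.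
Qed.

(* [A] is clopen in the disjoint sum [Z + A], which maps perfectly onto [Z]. *)
Lemma P_closed_hereditary (Z : Space) (A : Z -> Prop) :
  tychonoff Z -> P Z -> is_closed A -> P (subspace Z A).
Proof.
  intros hZ pZ hA.
  assert (tA : tychonoff (subspace Z A)) by (apply tychonoff_subspace; auto).
  assert (tS : tychonoff (sum_space Z (subspace Z A))) by (apply tychonoff_sum; auto).
  assert (pS : P (sum_space Z (subspace Z A))).
  { apply (P_perfect (sum_elim (fun z : Z => z) (@proj1_sig Z A)
      : sum_space Z (subspace Z A) -> Z)); auto.
    apply (@sum_elim_perfect Z (subspace Z A) Z).
    - split; [intros V hV; exact hV | split; [auto |]].
      intros U hU; exists U; split; [auto | tauto].
    - apply embedding_proj1.
    - intros D hD; apply (open_ext _ (fun x => ~ D x)); auto.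
      intro x; split; intros h k; apply h; [destruct k as [y [k ->]]; auto | exists x; auto].
    - apply closed_map_proj1; auto.
    - eauto. }
  apply (P_subspace_full _ (fun _ => True)); [auto | auto |].
  apply (P_embedding (inr : subspace Z A -> sum_space Z (subspace Z A)) _
    (fun z => ~ is_left z)); auto.
  - apply embedding_inr.
  - intros [z | z]; simpl; split; try tauto.
    + intros [s [_ h]]; discriminate h.
    + eauto.
  - destruct HP as [h _]; apply h; auto; [apply open_right |].
    apply closed_compl, open_left.
Qed.

Lemma P_closed_subset (Z : Space) (A D : Z -> Prop) :
  tychonoff Z -> P (subspace Z D) -> is_closed A -> (forall z, A z -> D z) ->
  P (subspace Z A).
Proof.
  intros hZ pD hA hAD.
  apply (P_embedding (@proj1_sig Z D : subspace Z D -> Z) (fun z => A (proj1_sig z))); auto.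
  - apply tychonoff_subspace; auto.
  - apply embedding_proj1.
  - intro t; split; [intro h; exists (exist _ t (hAD t h)); auto |].
    intros [s [h <-]]; auto.
  - apply P_closed_hereditary; auto.
    + apply tychonoff_subspace; auto.
    + apply closed_subspace; auto.
Qed.

(** Finite additivity with the empty list of pieces. *)
Lemma P_empty (Z : Space) (A : Z -> Prop) :
  tychonoff Z -> (forall z, ~ A z) -> P (subspace Z A).
Proof.
  intros hZ hA; destruct HP as [_ [h _]]; apply (h _ nil).
  - apply tychonoff_subspace; auto.
  - intros D [].
  - intros [z hz]; destruct (hA z hz).
  - simpl; lia.
Qed.

Lemma P_sum (S T : Space) :
  tychonoff S -> tychonoff T -> P S -> P T -> P (sum_space S T).
Proof.
  intros hS hT pS pT.
  assert (tS : tychonoff (sum_space S T)) by (apply tychonoff_sum; auto).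
  destruct HP as [_ [h _]].
  apply (h _ ((is_left : sum_space S T -> Prop) :: (fun z => ~ is_left z) :: nil)); auto.
  - intros A [<- | [<- | []]].
    + split; [apply open_right |].
      apply (P_embedding (inl : S -> sum_space S T) (fun _ => True)); auto.
      * apply embedding_inl.
      * intros [z | z]; simpl; split; try tauto; [eauto | intros [s [_ k]]; discriminate k].
      * apply P_subspace_full; auto.
    + split; [apply closed_compl, open_left |].
      apply (P_embedding (inr : T -> sum_space S T) (fun _ => True)); auto.
      * apply embedding_inr.
      * intros [z | z]; simpl; split; try tauto; [intros [s [_ k]]; discriminate k | eauto].
      * apply P_subspace_full; auto.
  - intros [x | x]; [exists is_left | exists (fun z => ~ is_left z)]; simpl; tauto.
  - intros [| [| i]] [| [| j]] hi hj hij x; simpl in *; try tauto; lia.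
Qed.

(** Finite additivity concerns disjoint pieces only; overlapping ones are made disjoint in a sum,
    which maps perfectly onto the union. *)
Lemma P_union (Z : Space) (A D : Z -> Prop) :
  tychonoff Z -> is_closed A -> is_closed D ->
  P (subspace Z A) -> P (subspace Z D) -> P (subspace Z (fun z => A z \/ D z)).
Proof.
  intros hZ hA hD pA pD.
  set (W := subspace Z (fun z => A z \/ D z)).
  assert (tW : tychonoff W) by (apply tychonoff_subspace; auto).
  assert (qA : P (subspace W (fun w => A (proj1_sig w)))).
  { apply (P_embedding (@proj1_sig _ _ : W -> Z) _ A); auto; [apply embedding_proj1 |].
    intro t; split; [intro h; exists (exist _ t (or_introl h)); auto |].
    intros [s [h <-]]; auto. }
  assert (qD : P (subspace W (fun w => D (proj1_sig w)))).
  { apply (P_embedding (@proj1_sig _ _ : W -> Z) _ D); auto; [apply embedding_proj1 |].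
    intro t; split; [intro h; exists (exist _ t (or_intror h)); auto |].
    intros [s [h <-]]; auto. }
  apply (P_perfect (sum_elim (@proj1_sig _ _) (@proj1_sig _ _)
    : sum_space (subspace W (fun w => A (proj1_sig w)))
        (subspace W (fun w => D (proj1_sig w))) -> W)); auto.
  - apply tychonoff_sum; apply tychonoff_subspace; auto.
  - apply (@sum_elim_perfect (subspace W (fun w => A (proj1_sig w)))
      (subspace W (fun w => D (proj1_sig w))) W); try apply embedding_proj1;
      try (apply closed_map_proj1, closed_subspace; auto).
    intro w; destruct (proj2_sig w) as [h | h]; [left | right];
      exists (exist _ w h); reflexivity.
  - apply P_sum; auto; apply tychonoff_subspace; auto.
Qed.

End CompactnessLike.

(** * The unit interval *)

Definition real_line : Space.
Proof.
  refine {| carrier := R; is_open := fun U => forall x, U x ->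
    exists eps, (0 < eps)%R /\ forall y, (Rabs (y - x) < eps)%R -> U y |}.
  - intros U V h hU x hx; destruct (hU x) as [e [h1 h2]]; [apply h; auto |].
    exists e; split; auto; intros y hy; apply h; auto.
  - intros x _; exists 1%R; split; [lra | auto].
  - intros U V hU hV x [h1 h2]; destruct (hU x h1) as [e [e0 he]].
    destruct (hV x h2) as [d [d0 hd]]; exists (Rmin e d); split; [apply Rmin_pos; auto |].
    intros y hy; generalize (Rmin_l e d) (Rmin_r e d); intros.
    split; [apply he | apply hd]; lra.
  - intros F hF x [U [hU hx]]; destruct (hF U hU x hx) as [e [h1 h2]].
    exists e; split; auto; intros y hy; eauto.
Defined.

Definition unit_interval : Space := subspace real_line (fun t => (0 <= t <= 1)%R).

Lemma open_interval (a b : R) : @is_open real_line (fun x => (a < x < b)%R).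
Proof.
  intros x hx; exists (Rmin (x - a) (b - x)); split; [apply Rmin_pos; lra |].
  intros y hy; generalize (Rmin_l (x - a) (b - x)) (Rmin_r (x - a) (b - x)).
  intros; apply Rabs_def2 in hy; lra.
Qed.

Lemma hausdorff_unit_interval : hausdorff unit_interval.
Proof.
  apply hausdorff_subspace; intros x y hxy.
  set (m := ((x + y) / 2)%R).
  destruct (Rlt_le_dec x y) as [h | h].
  - exists (fun z => (x - 1 < z < m)%R), (fun z => (m < z < y + 1)%R).
    split; [apply open_interval | split; [apply open_interval |]].
    unfold m; split; [lra | split; [lra | intros; lra]].
  - assert (y < x)%R by (destruct h; [auto | congruence]).
    exists (fun z => (m < z < x + 1)%R), (fun z => (y - 1 < z < m)%R).
    split; [apply open_interval | split; [apply open_interval |]].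
    unfold m; split; [lra | split; [lra | intros; lra]].
Qed.

Lemma compact_unit_interval : compact unit_interval.
Proof.
  apply (compact_ext (fun x : unit_interval => (fun t => (0 <= t <= 1)%R) (proj1_sig x))).
  { intro x; split; [auto | intros _; exact (proj2_sig x)]. }
  apply (@compact_subspace real_line (fun t => (0 <= t <= 1)%R)
    (fun t => (0 <= t <= 1)%R)); [| auto].
  intros F hF hc.
  (* Heine-Borel by a supremum: a member of the cover around [m] extends a finite cover past [m],
     which is possible only once 1 is reached. *)
  set (E := fun t : R => (0 <= t <= 1)%R /\ exists l : list (real_line -> Prop),
    (forall U, In U l -> F U) /\ forall x : R, (0 <= x <= t)%R -> exists U, In U l /\ U x).
  assert (E0 : E 0%R).
  { split; [lra |]; destruct (hc 0%R) as [U [hU hU0]]; [lra |].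
    exists (U :: nil); split; [intros V [<- | []]; auto |].
    intros x hx; exists U; split; [left; auto |]; replace x with 0%R by lra; auto. }
  destruct (completeness E) as [m [hub hlub]].
  - exists 1%R; intros t [h _]; lra.
  - eauto.
  - assert (m0 : (0 <= m)%R) by (apply hub; auto).
    assert (m1 : (m <= 1)%R) by (apply hlub; intros t [h _]; lra).
    destruct (hc m) as [U [hU hUm]]; [lra |].
    destruct (hF U hU m hUm) as [e [e0 he]].
    assert (ht : exists t, E t /\ (m - e < t)%R).
    { apply NNPP; intro h.
      assert (k : (m <= m - e)%R); [| lra].
      apply hlub; intros t ht; apply Rnot_lt_le; intro; apply h; eauto. }
    destruct ht as [t [[ht [l [l1 l2]]] htm]].
    assert (cov : forall x : R, (0 <= x < m + e)%R -> exists V, In V (U :: l) /\ V x).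
    { intros x hx; destruct (Rle_dec x t) as [k | k].
      - destruct (l2 x) as [V [v1 v2]]; [lra |]; exists V; split; [right; auto | auto].
      - exists U; split; [left; auto | apply he, Rabs_def1; lra]. }
    assert (hl : forall V, In V (U :: l) -> F V) by (intros V [<- | h]; auto).
    destruct (Rle_dec 1 (m + e / 2)) as [k | k].
    + exists (U :: l); split; auto; intros x hx; apply cov; lra.
    + assert (h : (m + e / 2 <= m)%R); [| lra].
      apply hub; split; [lra |]; exists (U :: l); split; auto.
      intros x hx; apply cov; lra.
Qed.

(** The universal property speaks of compact Hausdorff targets; the bound on [h] lets the unit
    interval serve as one. *)
Lemma stone_cech_extend (X B : Space) (e : X -> B) (h : X -> R) :
  is_stone_cech X B e -> rcontinuous h -> (forall x, (0 <= h x <= 1)%R) ->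
  exists g : B -> R, rcontinuous g /\ forall x, g (e x) = h x.
Proof.
  intros [_ [_ [_ [_ hu]]]] hc h01.
  destruct (hu unit_interval (fun x => exist _ (h x) (h01 x))) as [g [g1 g2]].
  - exact compact_unit_interval.
  - exact hausdorff_unit_interval.
  - apply continuous_into_subspace; simpl; intros V hV.
    apply open_local; intros x hx; destruct (hV _ hx) as [eps [e0 he]].
    destruct (proj1 (rcontinuous_iff h) hc x eps e0) as [U [u1 [u2 u3]]].
    exists U; auto.
  - exists (fun p => proj1_sig (g p)); split.
    + intros a b; apply (g1 (fun t => (a < proj1_sig t < b)%R)).
      exists (fun t : R => (a < t < b)%R); split; [apply open_interval | tauto].
    + intro x; rewrite g2; reflexivity.
Qed.

(** * The poset of closed partial equivalence relations *)

Definition subrel {B : Type} (r s : B -> B -> Prop) : Prop :=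
  forall p q, r p q -> s p q.

Lemma subrel_antisym {B : Type} (r s : B -> B -> Prop) :
  subrel r s -> subrel s r -> r = s.
Proof.
  intros h1 h2; apply functional_extensionality; intro p.
  apply functional_extensionality; intro q.
  apply propositional_extensionality; split; auto.
Qed.

(** Closedness in the square of [B], expressed by open rectangles instead of a product topology. *)
Definition closed_rel {B : Space} (r : B -> B -> Prop) : Prop :=
  forall p q, ~ r p q -> exists U V, is_open U /\ is_open V /\ U p /\ V q /\
    forall p' q', U p' -> V q' -> ~ r p' q'.

(** [C] will be the complement of [lambda_P X] and [N] the whole Stone-Cech remainder. Reflexivity
    is asked on [C] only: the domain, formed by the [p] with [r p p], may be larger. *)
Record admissible {B : Space} (C N : B -> Prop) (r : B -> B -> Prop) : Prop := {
  adm_closed : closed_rel r;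
  adm_sym : forall p q, r p q -> r q p;
  adm_trans : forall p q s, r p q -> r q s -> r p s;
  adm_support : forall p q, r p q -> N p;
  adm_refl : forall p, C p -> r p p
}.

Lemma closed_rel_or {B : Space} (r s : B -> B -> Prop) :
  closed_rel r -> closed_rel s -> closed_rel (fun p q => r p q \/ s p q).
Proof.
  intros hr hs p q h.
  destruct (hr p q) as [U [V [h1 [h2 [h3 [h4 h5]]]]]]; [tauto |].
  destruct (hs p q) as [U' [V' [k1 [k2 [k3 [k4 k5]]]]]]; [tauto |].
  exists (fun x => U x /\ U' x), (fun x => V x /\ V' x).
  split; [apply open_inter; auto | split; [apply open_inter; auto |]].
  split; [auto | split; [auto |]].
  intros p' q' [] [] [k | k]; [apply (h5 p' q') | apply (k5 p' q')]; auto.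
Qed.

Lemma closed_rel_square {B : Space} (A : B -> Prop) :
  is_closed A -> closed_rel (fun p q => A p /\ A q).
Proof.
  intros hA p q h; destruct (classic (A p)) as [k | k].
  - exists (fun _ => True), (fun x => ~ A x).
    split; [apply open_full | split; [exact hA | tauto]].
  - exists (fun x => ~ A x), (fun _ => True).
    split; [exact hA | split; [apply open_full | tauto]].
Qed.

Lemma closed_rel_diag {B : Space} (C : B -> Prop) :
  hausdorff B -> is_closed C -> closed_rel (fun p q => C p /\ p = q).
Proof.
  intros hB hC p q h; destruct (classic (p = q)) as [<- | k].
  - exists (fun x => ~ C x), (fun _ => True).
    split; [exact hC | split; [apply open_full | tauto]].
  - destruct (hB p q k) as [U [V [h1 [h2 [h3 [h4 h5]]]]]].
    exists U, V; repeat (split; [assumption |]); intros p' q' u v [_ <-]; eauto.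
Qed.

Lemma closed_rel_class {B : Space} (r : B -> B -> Prop) (a : B) :
  closed_rel r -> is_closed (fun q => r a q).
Proof.
  intro hr; apply open_local; intros q hq.
  destruct (hr a q hq) as [U [V [h1 [h2 [h3 [h4 h5]]]]]].
  exists V; split; [auto | split; [auto |]]; intros y hy; auto.
Qed.

(** Two blocks suffice for all the special relations used below: a pair, a triple, two disjoint
    pairs, or a closed subset of [C]. *)
Definition collapse {B : Type} (C A1 A2 : B -> Prop) (p q : B) : Prop :=
  (C p /\ p = q) \/ (A1 p /\ A1 q) \/ (A2 p /\ A2 q).

(** Both kinds of cover have this form: [a] and [b] distinct in [C], or [a] and [b] equal and
    outside [C]. *)
Definition pair_rel {B : Type} (C : B -> Prop) (a b : B) : B -> B -> Prop :=
  collapse C (fun p => p = a \/ p = b) (fun _ => False).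

Record setting {B : Space} (C N : B -> Prop) : Prop := {
  set_hausdorff : hausdorff B;
  set_closed : is_closed C;
  set_sub : forall p, C p -> N p;
  set_inh : exists c, C c
}.

Lemma pair_inv {B : Type} (C : B -> Prop) (a b x y : B) :
  pair_rel C a b x y -> (x = y /\ (C x \/ x = a \/ x = b)) \/ (x = a /\ y = b) \/ (x = b /\ y = a).
Proof. unfold pair_rel, collapse; intuition congruence. Qed.

Lemma pair_self {B : Type} (C : B -> Prop) (a b : B) : pair_rel C a b a b.
Proof. right; left; auto. Qed.

Lemma pair_sym {B : Type} (C : B -> Prop) (a b : B) : pair_rel C a b = pair_rel C b a.
Proof. apply subrel_antisym; intros x y; unfold pair_rel, collapse; tauto. Qed.

Lemma pair_inj {B : Type} (C : B -> Prop) (a b x y : B) :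
  a <> b -> pair_rel C a b = pair_rel C x y -> (a = x /\ b = y) \/ (a = y /\ b = x).
Proof.
  intros hab e; generalize (pair_self C a b); rewrite e; intro h.
  apply pair_inv in h; tauto.
Qed.

(** * The two kinds of covers of the least relation *)

Section OneSpace.

Variables (B : Space) (C N : B -> Prop).
Hypothesis HS : setting C N.

Definition is_bot (r : B -> B -> Prop) : Prop :=
  forall s, admissible C N s -> subrel r s.

Definition atom (r : B -> B -> Prop) : Prop :=
  admissible C N r /\ ~ is_bot r /\
  forall s, admissible C N s -> subrel s r -> is_bot s \/ s = r.

(* Among the atoms, those adding a point outside [C] are recognised by the
   existence of a strictly larger relation that contains no other atom. *)
Definition point_like (r : B -> B -> Prop) : Prop :=
  exists z, admissible C N z /\ subrel r z /\ z <> r /\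
    forall s, atom s -> subrel s z -> s = r.

Lemma admissible_collapse (A1 A2 : B -> Prop) :
  is_closed A1 -> is_closed A2 -> (forall p, A1 p -> N p) -> (forall p, A2 p -> N p) ->
  (forall p, A1 p -> A2 p -> False) -> admissible C N (collapse C A1 A2).
Proof.
  intros c1 c2 n1 n2 hd; unfold collapse; split.
  - apply closed_rel_or; [| apply closed_rel_or; apply closed_rel_square; auto].
    apply closed_rel_diag; apply HS.
  - intros p q [[h <-] | [h | h]]; tauto.
  - intros p q s [[h <-] | [h | h]] [[k <-] | [k | k]]; try tauto; exfalso.
    + apply (hd q); tauto.
    + apply (hd q); tauto.
  - intros p q [[h _] | [[h _] | [h _]]]; auto; apply HS; auto.
  - auto.
Qed.

Lemma closed_two (a b : B) : is_closed (fun p => p = a \/ p = b).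
Proof. apply closed_or; apply closed_point, HS. Qed.

Lemma admissible_pair a b : N a -> N b -> admissible C N (pair_rel C a b).
Proof.
  intros ha hb; apply admissible_collapse; auto.
  - apply closed_two.
  - apply closed_empty.
  - intros p [-> | ->]; auto.
  - tauto.
Qed.

(** Turns relatedness of two points into an inequality of the order, which is what an order
    isomorphism transports. *)
Lemma pair_sub r a b : admissible C N r -> (subrel (pair_rel C a b) r <-> r a b).
Proof.
  intro hr; split; [intro h; apply h, pair_self |].
  intros h p q [[k <-] | [[[-> | ->] [-> | ->]] | [[] _]]]; auto.
  - apply (adm_refl C N r); auto.
  - apply (adm_trans C N r hr a b a); auto; apply (adm_sym C N r hr); auto.
  - apply (adm_sym C N r hr); auto.
  - apply (adm_trans C N r hr b a b); auto; apply (adm_sym C N r hr); auto.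
Qed.

Lemma is_bot_iff r : is_bot r <-> forall x y, r x y -> C x /\ x = y.
Proof.
  split.
  - intros h x y hxy.
    assert (k : admissible C N (collapse C (fun _ => False) (fun _ => False))).
    { apply admissible_collapse; try apply closed_empty; tauto. }
    destruct (h _ k x y hxy) as [m | m]; tauto.
  - intros h s hs x y hxy; destruct (h x y hxy) as [k <-].
    apply (adm_refl C N s hs); auto.
Qed.

Lemma atom_pair a b : C a -> C b -> a <> b -> atom (pair_rel C a b).
Proof.
  intros ha hb hab; split; [| split].
  - apply admissible_pair; apply HS; auto.
  - intro h; apply hab, (proj1 (is_bot_iff _) h a b), pair_self.
  - intros s hs hsub; destruct (classic (s a b)) as [h | h].
    + right; apply subrel_antisym; auto; apply pair_sub; auto.
    + left; apply is_bot_iff; intros x y hxy.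
      destruct (pair_inv _ _ _ _ _ (hsub x y hxy)) as [[-> k] | [[-> ->] | [-> ->]]].
      * intuition congruence.
      * tauto.
      * apply (adm_sym C N s hs) in hxy; tauto.
Qed.

Lemma atom_point p : N p -> ~ C p -> atom (pair_rel C p p).
Proof.
  intros hp hc; split; [| split].
  - apply admissible_pair; auto.
  - intro h; destruct (proj1 (is_bot_iff _) h p p); auto; apply pair_self.
  - intros s hs hsub; destruct (classic (s p p)) as [h | h].
    + right; apply subrel_antisym; auto; apply pair_sub; auto.
    + left; apply is_bot_iff; intros x y hxy.
      destruct (pair_inv _ _ _ _ _ (hsub x y hxy)) as [[-> k] | [[-> ->] | [-> ->]]];
        try tauto.
      destruct k as [k | [-> | ->]]; tauto.
Qed.

Lemma refl_of_rel r x y : admissible C N r -> r x y -> r x x /\ r y y.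
Proof.
  intros hr h; assert (k := adm_sym C N r hr x y h).
  split; eapply (adm_trans C N r hr); eauto.
Qed.

(** A relation that is not least has a point outside [C] in its domain, or relates two distinct
    points of [C]. Either generates a cover below [r], and minimality makes it equal to [r]. *)
Lemma atom_cases r : atom r ->
  (exists p, N p /\ ~ C p /\ r = pair_rel C p p) \/
  (exists a b, C a /\ C b /\ a <> b /\ r = pair_rel C a b).
Proof.
  intros [hr [hb hmin]].
  assert (hout : forall p, r p p -> ~ C p -> exists p, N p /\ ~ C p /\ r = pair_rel C p p).
  { intros p h hc; assert (hN := adm_support C N r hr p p h).
    exists p; split; [auto | split; [auto |]].
    destruct (hmin (pair_rel C p p)) as [k | k]; auto.
    - apply admissible_pair; auto.
    - apply pair_sub; auto.
    - exfalso; apply (proj1 (proj2 (atom_point p hN hc))); auto. }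
  apply NNPP; intro h; apply hb, is_bot_iff; intros x y hxy.
  destruct (refl_of_rel r x y hr hxy) as [hx hy].
  assert (cx : C x) by (apply NNPP; intro; apply h; left; eauto).
  assert (cy : C y) by (apply NNPP; intro; apply h; left; eauto).
  split; auto; apply NNPP; intro hne; apply h; right; exists x, y.
  split; [auto | split; [auto | split; [auto |]]].
  destruct (hmin (pair_rel C x y)) as [k | k]; auto.
  - apply admissible_pair; apply HS; auto.
  - apply pair_sub; auto.
  - exfalso; apply (proj1 (proj2 (atom_pair x y cx cy hne))); auto.
Qed.

(** The larger relation glues [p] to a point [a] of [C]: it adds only [p] and identifies no two
    points of [C], so it contains a single atom. *)
Lemma point_is_point_like p : N p -> ~ C p -> point_like (pair_rel C p p).
Proof.
  intros hp hc; destruct (set_inh _ _ HS) as [a ha].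
  assert (hpa : p <> a) by (intros ->; auto).
  assert (hz : admissible C N (pair_rel C p a)).
  { apply admissible_pair; auto; apply HS; auto. }
  exists (pair_rel C p a); split; [auto | split; [| split]].
  - apply pair_sub; auto; right; left; auto.
  - intro e; destruct (pair_inj C p a p p hpa e) as [[_ k] | [_ k]]; auto.
  - intros s hs hsub; destruct (atom_cases s hs) as
      [[q [hq [hqc ->]]] | [c [d [c1 [c2 [c3 ->]]]]]].
    + generalize (pair_inv _ _ _ _ _ (hsub q q (pair_self _ _ _))).
      intros [[_ [k | [-> | ->]]] | [[-> _] | [_ ->]]]; tauto.
    + generalize (pair_inv _ _ _ _ _ (hsub c d (pair_self _ _ _))).
      intros [[k _] | [[-> _] | [_ ->]]]; tauto.
Qed.

(** If [z] contains no other atom, its domain has no point outside [C] and it identifies no further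
    pair, so [z] is this atom itself. *)
Lemma pair_not_point_like a b : C a -> C b -> a <> b -> ~ point_like (pair_rel C a b).
Proof.
  intros ha hb hab [z [hz [hsub [hne hat]]]]; apply hne, subrel_antisym; auto.
  intros x y hxy; destruct (refl_of_rel z x y hz hxy) as [hx hy].
  assert (hC : forall x, z x x -> C x).
  { intros u hu; apply NNPP; intro hc.
    assert (e : pair_rel C u u = pair_rel C a b).
    { apply hat; [apply atom_point; auto | apply pair_sub; auto].
      apply (adm_support C N z hz u u hu). }
    generalize (pair_self C u u); rewrite e; intro k.
    destruct (pair_inv _ _ _ _ _ k) as [[_ [m | [-> | ->]]] | [[-> _] | [-> _]]]; auto. }
  destruct (classic (x = y)) as [<- | hxy'].
  - left; auto.
  - rewrite <- (hat (pair_rel C x y)); [apply pair_self | apply atom_pair; auto |].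
    apply pair_sub; auto.
Qed.

Lemma proper_pair_iff r : (atom r /\ ~ point_like r) <->
  exists a b, C a /\ C b /\ a <> b /\ r = pair_rel C a b.
Proof.
  split.
  - intros [h k]; destruct (atom_cases r h) as [[p [h1 [h2 ->]]] | m]; auto.
    destruct k; apply point_is_point_like; auto.
  - intros [a [b [h1 [h2 [h3 ->]]]]]; split; [apply atom_pair; auto |].
    apply pair_not_point_like; auto.
Qed.

End OneSpace.

(** * Order isomorphisms between two posets of relations *)

Record rel_iso {B B' : Space} (C N : B -> Prop) (C' N' : B' -> Prop)
    (F : (B -> B -> Prop) -> B' -> B' -> Prop)
    (G : (B' -> B' -> Prop) -> B -> B -> Prop) : Prop := {
  iso_F : forall r, admissible C N r -> admissible C' N' (F r);
  iso_G : forall r, admissible C' N' r -> admissible C N (G r);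
  iso_GF : forall r, admissible C N r -> G (F r) = r;
  iso_FG : forall r, admissible C' N' r -> F (G r) = r;
  iso_monoF : forall r s, admissible C N r -> admissible C N s ->
    subrel r s -> subrel (F r) (F s);
  iso_monoG : forall r s, admissible C' N' r -> admissible C' N' s ->
    subrel r s -> subrel (G r) (G s)
}.

Lemma rel_iso_sym {B B' : Space} (C N : B -> Prop) (C' N' : B' -> Prop) F G :
  rel_iso C N C' N' F G -> rel_iso C' N' C N G F.
Proof. intros []; split; auto. Qed.

Section TwoSpaces.

Variables (B B' : Space) (C N : B -> Prop) (C' N' : B' -> Prop).
Variables (F : (B -> B -> Prop) -> B' -> B' -> Prop).
Variables (G : (B' -> B' -> Prop) -> B -> B -> Prop).
Hypothesis HI : rel_iso C N C' N' F G.

Lemma iso_sub r s : admissible C N r -> admissible C N s ->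
  (subrel (F r) (F s) <-> subrel r s).
Proof.
  intros hr hs; split; [| apply (iso_monoF _ _ _ _ _ _ HI); auto].
  intro h; apply (iso_monoG _ _ _ _ _ _ HI) in h; try (apply HI; auto).
  rewrite !(iso_GF _ _ _ _ _ _ HI) in h; auto.
Qed.

Lemma iso_bot r : admissible C N r -> is_bot B C N r -> is_bot B' C' N' (F r).
Proof.
  intros hr h s hs; rewrite <- (iso_FG _ _ _ _ _ _ HI s hs).
  apply (iso_monoF _ _ _ _ _ _ HI); auto; [apply HI; auto |].
  apply h; apply HI; auto.
Qed.

End TwoSpaces.

Lemma iso_bot_iff {B B' : Space} (C N : B -> Prop) (C' N' : B' -> Prop) F G r :
  rel_iso C N C' N' F G -> admissible C N r ->
  (is_bot B' C' N' (F r) <-> is_bot B C N r).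
Proof.
  intros HI hr; split; [| eapply iso_bot; eauto].
  intro h; rewrite <- (iso_GF _ _ _ _ _ _ HI r hr).
  eapply iso_bot; eauto; [apply rel_iso_sym; eauto | apply HI; auto].
Qed.

Lemma iso_atom {B B' : Space} (C N : B -> Prop) (C' N' : B' -> Prop) F G r :
  rel_iso C N C' N' F G -> atom B C N r -> atom B' C' N' (F r).
Proof.
  intros HI [h1 [h2 h3]]; split; [apply HI; auto | split].
  - rewrite iso_bot_iff; eauto.
  - intros s hs hsub.
    assert (hG := iso_G _ _ _ _ _ _ HI s hs).
    assert (e := iso_FG _ _ _ _ _ _ HI s hs).
    destruct (h3 (G s)) as [k | k]; auto.
    + apply (iso_sub _ _ C N C' N' F G HI); auto; rewrite e; auto.
    + left; rewrite <- e, iso_bot_iff; eauto.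
    + right; rewrite <- e, k; reflexivity.
Qed.

Lemma iso_point_like {B B' : Space} (C N : B -> Prop) (C' N' : B' -> Prop) F G r :
  rel_iso C N C' N' F G -> admissible C N r ->
  point_like B C N r -> point_like B' C' N' (F r).
Proof.
  intros HI hr [z [h1 [h2 [h3 h4]]]]; exists (F z).
  split; [apply HI; auto | split; [apply HI; auto | split]].
  - intro e; apply h3; rewrite <- (iso_GF _ _ _ _ _ _ HI z h1), e; apply HI; auto.
  - intros s hs hsub.
    assert (e := iso_FG _ _ _ _ _ _ HI s (proj1 hs)).
    rewrite <- e; f_equal; apply h4.
    + eapply iso_atom; eauto; apply rel_iso_sym; eauto.
    + apply (iso_sub _ _ C N C' N' F G HI); auto; [apply HI, hs |].
      rewrite e; auto.
Qed.

Lemma iso_pair {B B' : Space} (C N : B -> Prop) (C' N' : B' -> Prop) F G a b :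
  setting C N -> setting C' N' -> rel_iso C N C' N' F G -> C a -> C b -> a <> b ->
  exists x y, C' x /\ C' y /\ x <> y /\ F (pair_rel C a b) = pair_rel C' x y.
Proof.
  intros HS HS' HI ha hb hab.
  destruct (proj2 (proper_pair_iff B C N HS (pair_rel C a b))) as [h1 h2]; [eauto 7 |].
  apply (proj1 (proper_pair_iff B' C' N' HS' _)); split; [eapply iso_atom; eauto |].
  intro k; apply h2; rewrite <- (iso_GF _ _ _ _ _ _ HI _ (proj1 h1)).
  eapply iso_point_like; eauto; [apply rel_iso_sym; eauto | apply HI, h1].
Qed.

(** * From pairs of points to points *)

Section Points.

Variables (B B' : Space) (C N : B -> Prop) (C' N' : B' -> Prop).
Variables (F : (B -> B -> Prop) -> B' -> B' -> Prop).
Variables (G : (B' -> B' -> Prop) -> B -> B -> Prop).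
Hypotheses (HS : setting C N) (HS' : setting C' N') (HI : rel_iso C N C' N' F G).

Lemma F_pair_inj a b c d : C a -> C b -> C c -> C d -> a <> b ->
  F (pair_rel C a b) = F (pair_rel C c d) -> (a = c /\ b = d) \/ (a = d /\ b = c).
Proof.
  intros ha hb hc hd hab e; apply (pair_inj C); auto.
  rewrite <- (iso_GF _ _ _ _ _ _ HI (pair_rel C a b)), e.
  - apply HI, admissible_pair; auto; apply HS; auto.
  - apply admissible_pair; auto; apply HS; auto.
Qed.

(* Any relation containing [pair_rel a b] and [pair_rel a c] contains [pair_rel b c]. *)
Lemma F_triangle a b c z : C a -> C b -> C c ->
  admissible C' N' z -> subrel (F (pair_rel C a b)) z -> subrel (F (pair_rel C a c)) z ->
  subrel (F (pair_rel C b c)) z.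
Proof.
  intros ha hb hc hz h1 h2.
  assert (adm : forall x y, C x -> C y -> admissible C N (pair_rel C x y)).
  { intros; apply admissible_pair; auto; apply HS; auto. }
  rewrite <- (iso_FG _ _ _ _ _ _ HI z hz) in *.
  assert (hG := iso_G _ _ _ _ _ _ HI z hz).
  rewrite (iso_sub _ _ C N C' N' F G HI) in * by auto.
  rewrite (pair_sub B C N) in * by auto.
  apply (adm_trans C N _ hG b a c); auto; apply (adm_sym C N _ hG); auto.
Qed.

(** Were the two image pairs disjoint, the relation with both as classes would contain the image of
    the pair [b c]. That image would then be one of the two, against injectivity. *)
Lemma F_share a b c x y u v : C a -> C b -> C c -> a <> b -> a <> c -> b <> c ->
  C' x -> C' y -> C' u -> C' v ->
  F (pair_rel C a b) = pair_rel C' x y -> F (pair_rel C a c) = pair_rel C' u v ->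
  x = u \/ x = v \/ y = u \/ y = v.
Proof.
  intros ha hb hc hab hac hbc hx hy hu hv e1 e2; apply NNPP; intro hno.
  destruct (iso_pair C N C' N' F G b c) as [s [t [hs [ht [hst e3]]]]]; auto.
  set (z := collapse C' (fun p => p = x \/ p = y) (fun p => p = u \/ p = v)).
  assert (hz : admissible C' N' z).
  { apply admissible_collapse; auto; try (apply (closed_two B' C' N'); auto).
    - intros p [-> | ->]; apply HS'; auto.
    - intros p [-> | ->]; apply HS'; auto.
    - intros p [-> | ->] [-> | ->]; tauto. }
  assert (k : z s t).
  { apply (pair_sub B' C' N'); auto; rewrite <- e3; apply (F_triangle a); auto.
    - rewrite e1; apply (pair_sub B' C' N'); auto; right; left; auto.
    - rewrite e2; apply (pair_sub B' C' N'); auto; right; right; auto. }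
  destruct k as [[_ k] | [[k1 k2] | [k1 k2]]]; auto.
  - assert (e : F (pair_rel C b c) = F (pair_rel C a b)).
    { rewrite e3, e1; destruct k1 as [-> | ->], k2 as [-> | ->]; auto; try tauto.
      apply pair_sym. }
    apply F_pair_inj in e; auto; intuition congruence.
  - assert (e : F (pair_rel C b c) = F (pair_rel C a c)).
    { rewrite e3, e2; destruct k1 as [-> | ->], k2 as [-> | ->]; auto; try tauto.
      apply pair_sym. }
    apply F_pair_inj in e; auto; intuition congruence.
Qed.

(** A point is seen as the star of all pairs through it; [a'] is the centre of the image of that
    star. *)
Definition star_image (a : B) (a' : B') : Prop :=
  C' a' /\ forall b, C b -> b <> a -> exists b', C' b' /\ b' <> a' /\
    F (pair_rel C a b) = pair_rel C' a' b'.

(** Pairwise meeting pairs form a star or a triangle. If [a b] and [a c] go to [x y] and [x w], then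
    [b c] goes to [y w], which rules out the triangle: the image of any further pair through [a]
    meets [x y] and [x w], hence contains [x]. *)
Lemma star_image_exists a b c : C a -> C b -> C c -> a <> b -> a <> c -> b <> c ->
  exists a', star_image a a'.
Proof.
  intros ha hb hc hab hac hbc.
  destruct (iso_pair C N C' N' F G a b) as [x0 [y0 [hx0 [hy0 [hxy0 e0]]]]]; auto.
  destruct (iso_pair C N C' N' F G a c) as [u [v [hu [hv [huv e2]]]]]; auto.
  assert (hw : exists x y w, C' x /\ C' y /\ C' w /\ x <> y /\ x <> w /\
     F (pair_rel C a b) = pair_rel C' x y /\ F (pair_rel C a c) = pair_rel C' x w).
  { destruct (F_share a b c x0 y0 u v) as [k | [k | [k | k]]]; auto; subst.
    - exists u, y0, v; auto 7.
    - exists v, y0, u; rewrite (pair_sym C' v u); auto 8.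
    - exists u, x0, v; rewrite (pair_sym C' u x0); auto 8.
    - exists v, x0, u; rewrite (pair_sym C' v x0), (pair_sym C' v u); auto 9. }
  clear x0 y0 hx0 hy0 hxy0 e0 u v hu hv huv e2.
  destruct hw as [x [y [w [hx [hy [hw [hxy [hxw [e1 e2]]]]]]]]].
  assert (hyw : y <> w).
  { intros <-; rewrite <- e2 in e1; apply F_pair_inj in e1; auto.
    intuition congruence. }
  assert (e3 : F (pair_rel C b c) = pair_rel C' y w).
  { destruct (iso_pair C N C' N' F G b c) as [s [t [hs [ht [hst e3]]]]]; auto.
    assert (n1 : F (pair_rel C b c) <> F (pair_rel C a b)).
    { intro e; apply F_pair_inj in e; auto; intuition congruence. }
    assert (n2 : F (pair_rel C b c) <> F (pair_rel C a c)).
    { intro e; apply F_pair_inj in e; auto; intuition congruence. }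
    (* The relation with the class [x y w] contains the images of [a b] and [a c], hence that of
       [b c]; the only pair of this class not yet taken is [y w]. *)
    assert (tri : subrel (F (pair_rel C b c)) (collapse C' (fun p => p = x \/ p = y \/ p = w)
      (fun _ => False))).
    { apply (F_triangle a); auto.
      - apply admissible_collapse; auto.
        + apply closed_or; [apply closed_point, HS' | apply (closed_two B' C' N'); auto].
        + apply closed_empty.
        + intros p [-> | [-> | ->]]; apply HS'; auto.
        + tauto.
      - rewrite e1; intros p q; unfold pair_rel, collapse; tauto.
      - rewrite e2; intros p q; unfold pair_rel, collapse; tauto. }
    rewrite e3 in *; rewrite e1 in n1; rewrite e2 in n2.
    destruct (tri s t (pair_self _ _ _)) as [[_ m] | [[m1 m2] | [[] _]]]; [tauto |].
    destruct m1 as [-> | [-> | ->]], m2 as [-> | [-> | ->]]; try tauto;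
      try (destruct n1; (reflexivity || apply pair_sym));
      try (destruct n2; (reflexivity || apply pair_sym));
      (reflexivity || apply pair_sym). }
  exists x; split; auto; intros d hd hda.
  destruct (classic (d = b)) as [-> | hdb]; [exists y; auto |].
  destruct (classic (d = c)) as [-> | hdc]; [exists w; auto |].
  destruct (iso_pair C N C' N' F G a d) as [s [t [hs [ht [hst e4]]]]]; auto.
  assert (n : F (pair_rel C a d) <> F (pair_rel C b c)).
  { intro e; apply F_pair_inj in e; auto; intuition congruence. }
  assert (k1 := F_share a b d x y s t ha hb hd hab (not_eq_sym hda) (not_eq_sym hdb)
    hx hy hs ht e1 e4).
  assert (k2 := F_share a c d x w s t ha hc hd hac (not_eq_sym hda) (not_eq_sym hdc)
    hx hw hs ht e2 e4).
  rewrite e3, e4 in n.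
  destruct (classic (x = s)) as [-> | hxs]; [exists t; auto |].
  destruct (classic (x = t)) as [-> | hxt].
  - exists s; split; [auto | split; [auto |]]; rewrite e4; apply pair_sym.
  (* Avoiding [x], the image could only be the pair [y w], already the image of [b c]. *)
  - exfalso; apply n.
    destruct k1 as [k1 | [k1 | [k1 | k1]]], k2 as [k2 | [k2 | [k2 | k2]]];
      subst; try tauto; (reflexivity || apply pair_sym).
Qed.

End Points.

Definition three_points {B : Type} (C : B -> Prop) : Prop :=
  exists a b c, C a /\ C b /\ C c /\ a <> b /\ a <> c /\ b <> c.

Lemma three_points_others {B : Type} (C : B -> Prop) (p : B) :
  three_points C -> C p -> exists b c, C b /\ C c /\ p <> b /\ p <> c /\ b <> c.
Proof.
  intros [a [b [c [ha [hb [hc [hab [hac hbc]]]]]]]] hp.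
  destruct (classic (p = a)) as [-> | h1]; [exists b, c; auto |].
  destruct (classic (p = b)) as [-> | h2]; [exists a, c; auto 6 |].
  exists a, b; auto.
Qed.

Record pair_bijection {B B' : Type} (C : B -> Prop) (C' : B' -> Prop)
    (F : (B -> B -> Prop) -> B' -> B' -> Prop) (f : B -> B') (g : B' -> B) : Prop := {
  bij_f : forall p, C p -> C' (f p);
  bij_g : forall q, C' q -> C (g q);
  bij_gf : forall p, C p -> g (f p) = p;
  bij_fg : forall q, C' q -> f (g q) = q;
  bij_pair : forall a b, C a -> C b -> a <> b -> F (pair_rel C a b) = pair_rel C' (f a) (f b)
}.

Section Bijection.

Variables (B B' : Space) (C N : B -> Prop) (C' N' : B' -> Prop).
Variables (F : (B -> B -> Prop) -> B' -> B' -> Prop).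
Variables (G : (B' -> B' -> Prop) -> B -> B -> Prop).
Hypotheses (HS : setting C N) (HS' : setting C' N') (HI : rel_iso C N C' N' F G).

Lemma star_image_total : three_points C ->
  exists f : B -> B', forall p, C p -> star_image B B' C C' F p (f p).
Proof.
  intro h; apply choice with (Q := fun p q => C p -> star_image B B' C C' F p q).
  intro p; destruct (classic (C p)) as [hp | hp].
  - destruct (three_points_others C p h hp) as [b [c [hb [hc [h1 [h2 h3]]]]]].
    destruct (star_image_exists B B' C N C' N' F G HS HS' HI p b c) as [q hq]; auto.
    exists q; auto.
  - destruct (set_inh _ _ HS') as [c hc]; exists c; tauto.
Qed.

(** The point [a''] lies in every pair through [a]; two such pairs with different second points
    leave only [a]. *)
Lemma star_image_inverse a a' a'' : three_points C -> C a ->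
  star_image B B' C C' F a a' -> star_image B' B C' C G a' a'' -> a'' = a.
Proof.
  intros h ha [ha' h1] [ha'' h2].
  assert (k : forall b, C b -> b <> a -> a'' = a \/ a'' = b).
  { intros b hb hba; destruct (h1 b hb hba) as [b' [hb' [hn e]]].
    destruct (h2 b' hb' hn) as [b'' [hb'' [hn' e']]].
    rewrite <- e, (iso_GF _ _ _ _ _ _ HI) in e'.
    - symmetry in e'; apply pair_inj in e'; auto; tauto.
    - apply admissible_pair; auto; apply HS; auto. }
  destruct (three_points_others C a h ha) as [b [c [hb [hc [n1 [n2 n3]]]]]].
  destruct (k b) as [k1 | k1]; auto; destruct (k c) as [k2 | k2]; auto; congruence.
Qed.

Lemma iso_three_points : three_points C -> three_points C'.
Proof.
  intro h; assert (h' := h); destruct h' as [a [b [c [ha [hb [hc [n1 [n2 n3]]]]]]]].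
  destruct (star_image_exists B B' C N C' N' F G HS HS' HI a b c) as [x [hx k]]; auto.
  destruct (k b) as [y [hy [m1 e1]]]; auto; destruct (k c) as [z [hz [m2 e2]]]; auto.
  exists x, y, z; repeat (split; [solve [auto] |]); intros ->.
  rewrite <- e2 in e1; eapply F_pair_inj in e1; eauto; intuition congruence.
Qed.

End Bijection.

Lemma pair_bijection_exists {B B' : Space} (C N : B -> Prop) (C' N' : B' -> Prop) F G :
  setting C N -> setting C' N' -> rel_iso C N C' N' F G ->
  exists f g, pair_bijection C C' F f g.
Proof.
  intros HS HS' HI; assert (HI' := rel_iso_sym _ _ _ _ _ _ HI).
  destruct (classic (three_points C)) as [h3 | h3].
  - assert (h3' := iso_three_points _ _ _ _ _ _ _ _ HS HS' HI h3).
    destruct (star_image_total _ _ _ _ _ _ _ _ HS HS' HI h3) as [f hf].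
    destruct (star_image_total _ _ _ _ _ _ _ _ HS' HS HI' h3') as [g hg].
    assert (hgf : forall p, C p -> g (f p) = p).
    { intros p hp; eapply (star_image_inverse B B'); eauto; apply hg, hf; auto. }
    exists f, g; split; auto.
    + intros p hp; apply hf; auto.
    + intros q hq; apply hg; auto.
    + intros q hq; eapply (star_image_inverse B' B); eauto; apply hf, hg; auto.
    + intros a b ha hb hab.
      destruct (proj2 (hf a ha) b hb) as [x [hx [n1 e1]]]; auto.
      destruct (proj2 (hf b hb) a ha) as [y [hy [n2 e2]]]; auto.
      assert (n : f a <> f b) by (intro e; apply hab; rewrite <- (hgf a), <- (hgf b), e; auto).
      (* The image of [a b] is a pair through [f a] and, read from [b], a pair through [f b]. These
         points differ, so they are its two members. *)
      assert (e : pair_rel C' (f a) x = pair_rel C' (f b) y).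
      { rewrite <- e1, <- e2; f_equal; apply pair_sym. }
      destruct (pair_inj C' _ _ _ _ (not_eq_sym n1) e) as [[k _] | [k1 k2]]; [tauto |].
      rewrite e1, k2; reflexivity.
  - assert (h3' : ~ three_points C').
    { intro k; apply h3; exact (iso_three_points _ _ _ _ _ _ _ _ HS' HS HI' k). }
    destruct (classic (exists a b, C a /\ C b /\ a <> b)) as [[a [b [ha [hb hab]]]] | h2].
    (* With exactly two points there is one pair and no star singles out a point; either bijection
       respects that pair. *)
    + destruct (iso_pair C N C' N' F G a b) as [x [y [hx [hy [hxy e]]]]]; auto.
      assert (hC : forall p, C p -> p = a \/ p = b).
      { intros p hp; apply NNPP; intro k; apply h3; exists a, b, p.
        repeat split; auto; intros ->; tauto. }
      assert (hC' : forall p, C' p -> p = x \/ p = y).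
      { intros p hp; apply NNPP; intro k; apply h3'; exists x, y, p.
        repeat split; auto; intros ->; tauto. }
      set (f := fun p => if excluded_middle_informative (p = a) then x else y).
      set (g := fun q => if excluded_middle_informative (q = x) then a else b).
      assert (fa : f a = x).
      { unfold f; destruct (excluded_middle_informative (a = a)); tauto. }
      assert (fb : f b = y).
      { unfold f; destruct (excluded_middle_informative (b = a)); congruence. }
      assert (gx : g x = a).
      { unfold g; destruct (excluded_middle_informative (x = x)); tauto. }
      assert (gy : g y = b).
      { unfold g; destruct (excluded_middle_informative (y = x)); congruence. }
      clearbody f g; exists f, g; split.
      * intros p hp; destruct (hC p hp) as [-> | ->]; congruence.
      * intros p hp; destruct (hC' p hp) as [-> | ->]; congruence.
      * intros p hp; destruct (hC p hp) as [-> | ->]; congruence.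
      * intros p hp; destruct (hC' p hp) as [-> | ->]; congruence.
      * intros p q hp hq hpq.
        destruct (hC p hp) as [-> | ->], (hC q hq) as [-> | ->]; try tauto.
        -- congruence.
        -- rewrite fa, fb, (pair_sym C), e; apply pair_sym.
    + destruct (set_inh _ _ HS) as [c hc], (set_inh _ _ HS') as [c' hc'].
      assert (hC : forall p, C p -> c = p).
      { intros p hp; apply NNPP; intro k; apply h2; eauto. }
      assert (hC' : forall p, C' p -> c' = p).
      { intros p hp; apply NNPP; intro k.
        destruct (iso_pair C' N' C N G F c' p) as [x [y [hx [hy [hxy e]]]]]; auto.
        apply h2; eauto. }
      exists (fun _ => c'), (fun _ => c); split; auto.
      intros a b ha hb hab; destruct hab; rewrite <- (hC a), <- (hC b); auto.
Qed.

Lemma pair_bijection_sym {B B' : Space} (C N : B -> Prop) (C' N' : B' -> Prop) F G f g :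
  setting C N -> rel_iso C N C' N' F G ->
  pair_bijection C C' F f g -> pair_bijection C' C G g f.
Proof.
  intros HS HI [h1 h2 h3 h4 h5]; split; auto.
  intros a b ha hb hab.
  rewrite <- (h4 a ha) at 1; rewrite <- (h4 b hb) at 1; rewrite <- h5; auto.
  - apply HI, admissible_pair; auto; apply HS; auto.
  - intro e; apply hab; rewrite <- (h4 a), <- (h4 b), e; auto.
Qed.

(* If [A] has two points, its image is a class of the image of the relation collapsing [A]. *)
Lemma pair_bijection_closed {B B' : Space} (C N : B -> Prop) (C' N' : B' -> Prop)
    F G f g (A : B -> Prop) :
  setting C N -> setting C' N' -> rel_iso C N C' N' F G -> pair_bijection C C' F f g ->
  is_closed A -> (forall p, A p -> C p) -> is_closed (fun q => C' q /\ A (g q)).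
Proof.
  intros HS HS' HI Hb hA hAC.
  destruct (classic (exists a, A a)) as [[a ha] | h0].
  2:{ apply (open_ext _ (fun _ => True)); [| apply open_full].
      intro q; split; [intros _ [_ k]; eauto | auto]. }
  assert (ca := hAC a ha); assert (ca' := bij_f _ _ _ _ _ Hb a ca).
  set (r := collapse C A (fun _ => False)).
  assert (hr : admissible C N r).
  { apply admissible_collapse; auto; try apply closed_empty; [| tauto].
    intros p hp; apply HS; auto. }
  destruct (classic (exists b, A b /\ a <> b)) as [[b [hb hab]] | h1].
  - assert (hF := iso_F _ _ _ _ _ _ HI r hr).
    assert (haa : F r (f a) (f b)).
    { apply (pair_sub B' C' N'); auto; rewrite <- (bij_pair _ _ _ _ _ Hb); auto.
      apply HI; auto; [apply admissible_pair; auto; apply HS; auto |].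
      apply (pair_sub B C N); auto; right; left; auto. }
    (* No step ensures that [F r] has domain [C'], so the class of [f a] is cut down to the closed
       set [C']. *)
    apply (open_ext _ (fun q => ~ (C' q /\ F r (f a) q))).
    + assert (key : forall q, C' q -> (F r (f a) q <-> A (g q))).
      { intros q hq; assert (cg := bij_g _ _ _ _ _ Hb q hq).
        destruct (classic (a = g q)) as [e | n].
        - rewrite <- e; split; [auto | intros _].
          rewrite <- (bij_fg _ _ _ _ _ Hb q hq), <- e.
          (* [bij_pair] concerns distinct points; [f a] lies in its own class because it is related
             to [f b]. *)
          exact (proj1 (refl_of_rel _ _ _ _ _ _ hF haa)).
        - rewrite <- (bij_fg _ _ _ _ _ Hb q hq) at 1.
          rewrite <- (pair_sub B' C' N'), <- (bij_pair _ _ _ _ _ Hb) by auto.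
          rewrite (iso_sub _ _ C N C' N' F G HI), (pair_sub B C N)
            by (auto; apply admissible_pair; auto; apply HS; auto).
          split; [intros [[_ k] | [k | k]]; tauto | intro k; right; left; auto]. }
      intro q; split; intros h [k1 k2]; apply h; split; auto; apply key; auto.
    + apply closed_and; [apply HS' | apply closed_rel_class, hF].
  (* Here [A] is the point [a]. The collapsed relation is the least one and tells nothing, but the
     image is a point, hence closed. *)
  - apply (open_ext _ (fun q => ~ q = f a)); [| apply closed_point, HS'].
    intro q; split; intros h k; apply h.
    + destruct k as [k1 k2]; rewrite <- (bij_fg _ _ _ _ _ Hb q k1); f_equal.
      apply NNPP; intro n; apply h1; exists (g q); auto.
    + subst q; rewrite (bij_gf _ _ _ _ _ Hb); auto.
Qed.

Lemma pair_bijection_continuous {B B' : Space} (C N : B -> Prop) (C' N' : B' -> Prop)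
    F G f g (hg : forall q : subspace B' C', C (g (proj1_sig q))) :
  setting C N -> setting C' N' -> rel_iso C N C' N' F G -> pair_bijection C C' F f g ->
  continuous (fun q : subspace B' C' => exist C (g (proj1_sig q)) (hg q) : subspace B C).
Proof.
  intros HS HS' HI Hb; apply continuous_into_subspace; simpl; intros V hV.
  exists (fun q => ~ (C' q /\ (fun p => C p /\ ~ V p) (g q))); split.
  - apply (pair_bijection_closed C N C' N' F G f g (fun p => C p /\ ~ V p)); auto; [| tauto].
    apply closed_and; [apply HS | apply closed_compl; auto].
  - intros [q hq]; specialize (hg (exist _ q hq)); simpl in *.
    split; [tauto | intro h; apply NNPP; tauto].
Qed.

Theorem rel_iso_homeomorphic {B B' : Space} (C N : B -> Prop) (C' N' : B' -> Prop) F G :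
  setting C N -> setting C' N' -> rel_iso C N C' N' F G ->
  homeomorphic (subspace B C) (subspace B' C').
Proof.
  intros HS HS' HI.
  destruct (pair_bijection_exists C N C' N' F G HS HS' HI) as [f [g Hb]].
  assert (Hb' := pair_bijection_sym C N C' N' F G f g HS HI Hb).
  assert (hf : forall p : subspace B C, C' (f (proj1_sig p))).
  { intros [p hp]; apply Hb; auto. }
  assert (hg : forall q : subspace B' C', C (g (proj1_sig q))).
  { intros [q hq]; apply Hb; auto. }
  exists (fun p => exist _ _ (hf p)), (fun q => exist _ _ (hg q)).
  split; [| split; [| split]].
  - apply (pair_bijection_continuous C' N' C N G F g f hf); auto.
    apply rel_iso_sym; auto.
  - apply (pair_bijection_continuous C N C' N' F G f g hg); auto.
  - intros [p hp]; apply sig_eq; simpl; apply Hb; auto.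
  - intros [q hq]; apply sig_eq; simpl; apply Hb; auto.
Qed.

(** * Quotients of compact Hausdorff spaces *)

Section Quotient.

Variables (B : Space) (E : B -> B -> Prop).
Hypotheses (Erefl : forall p, E p p) (Esym : forall p q, E p q -> E q p).
Hypotheses (Etrans : forall p q s, E p q -> E q s -> E p s) (Eclosed : closed_rel E).
Hypotheses (cB : compact B) (hB : hausdorff B).

Definition cls (p : B) : {c : B -> Prop | exists p, c = E p} :=
  exist _ (E p) (ex_intro _ p eq_refl).

Definition quotient : Space.
Proof.
  refine {| carrier := {c : B -> Prop | exists p, c = E p};
            is_open := fun U => is_open (fun p => U (cls p)) |}.
  - intros U V h; apply open_ext; intro p; apply h.
  - apply open_full.
  - intros U V; apply open_inter.
  - intros F hF; apply open_local; intros p [U [hU hp]].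
    exists (fun p => U (cls p)); split; [apply hF; auto | split; eauto].
Defined.

Lemma cls_eq p q : cls p = cls q <-> E p q.
Proof.
  split.
  - intro h; apply (f_equal (@proj1_sig _ _)) in h; simpl in h.
    rewrite h; apply Erefl.
  - intro h; apply sig_eq; simpl; apply functional_extensionality; intro s.
    apply propositional_extensionality; split; eauto.
Qed.

Lemma cls_surj (t : quotient) : exists p, cls p = t.
Proof. destruct t as [c [p ->]]; exists p; reflexivity. Qed.

Lemma continuous_cls : @continuous B quotient cls.
Proof. intros V hV; exact hV. Qed.

(** A saturation is the projection of a closed relation along the compact set [A], so a tube around
    an outside point avoids it. *)
Lemma closed_saturation (A : B -> Prop) :
  is_closed A -> is_closed (fun q => exists p, A p /\ E p q).
Proof.
  intro hA; apply open_local; intros q hq.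
  destruct (tube A (fun p q => E p q) q) as [V [h1 [h2 h3]]].
  - apply (compact_closed_subset (fun _ => True)); auto.
  - intros p hp; apply Eclosed; intro h; apply hq; eauto.
  - exists V; split; [auto | split; [auto |]].
    intros y hy [p [hp hE]]; apply (h3 p y); auto.
Qed.

Lemma compact_quotient : compact quotient.
Proof.
  apply (@compact_image B quotient cls (fun _ => True)); auto.
  - intros V hV x _ hx; exists (fun x => V (cls x)); auto.
  - intros t _; destruct (cls_surj t) as [p h]; eauto.
Qed.

Lemma hausdorff_quotient : hausdorff quotient.
Proof.
  intros t t' ht; destruct (cls_surj t) as [p <-], (cls_surj t') as [q <-].
  assert (hpq : ~ E p q) by (intro h; apply ht, cls_eq, h).
  destruct (normal_of_compact (E p) (E q)) as [U [V [h1 [h2 [h3 [h4 h5]]]]]]; auto.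
  - apply closed_rel_class; auto.
  - apply closed_rel_class; auto.
  - intros x k1 k2; apply hpq; eauto.
  (* The union of the classes lying inside an open set is the complement of the saturation of a
     closed set, hence open. *)
  - assert (hop : forall U : B -> Prop, is_open U ->
      @is_open quotient (fun t => forall p, cls p = t -> U p)).
    { intros W hW; simpl.
      apply (open_ext _ (fun q => ~ exists p, ~ W p /\ E p q)).
      - intro s; split.
        + intros k p' e; apply NNPP; intro hn; apply k; exists p'; split; auto.
          apply cls_eq; auto.
        + intros k [p' [k1 k2]]; apply k1, k, cls_eq; auto.
      - apply closed_saturation, closed_compl; auto. }
    exists (fun t => forall p, cls p = t -> U p), (fun t => forall p, cls p = t -> V p).
    split; [apply hop; auto | split; [apply hop; auto |]].
    split; [intros s hs; apply h3, Esym, cls_eq; auto |].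
    split; [intros s hs; apply h4, Esym, cls_eq; auto |].
    intros z k1 k2; destruct (cls_surj z) as [s hs]; apply (h5 s); auto.
Qed.

Lemma tychonoff_quotient : tychonoff quotient.
Proof. apply tychonoff_of_compact; [apply compact_quotient | apply hausdorff_quotient]. Qed.

End Quotient.

(** * Extensions as closed partial equivalence relations on the Stone-Cech remainder *)

Section StoneCech.

Variables (P : Space -> Prop) (X B : Space) (e : X -> B).
Hypotheses (HP : compactness_like P) (tX : tychonoff X) (SC : is_stone_cech X B e).

(** * The set [C] inside the Stone-Cech remainder *)

Definition growth (p : B) : Prop := ~ exists x, e x = p.
Definition core (p : B) : Prop := ~ lambda_P P X B e p.

Lemma sc_compact : compact B. Proof. apply SC. Qed.
Lemma sc_hausdorff : hausdorff B. Proof. apply SC. Qed.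
Lemma sc_embedding : embedding e. Proof. apply SC. Qed.

Lemma sc_tychonoff : tychonoff B.
Proof. apply tychonoff_of_compact; [apply sc_compact | apply sc_hausdorff]. Qed.

Lemma sc_dense (U : B -> Prop) p : is_open U -> U p -> exists x, U (e x).
Proof.
  destruct SC as [_ [_ [_ [h _]]]]; intros hU hp.
  destruct (h p U hU hp) as [q [hq [x [_ <-]]]]; eauto.
Qed.

Lemma closure_trace (D : X -> Prop) x : closure (image e D) (e x) -> closure D x.
Proof.
  intros h U hU hx; destruct sc_embedding as [_ [_ ho]].
  destruct (ho U hU) as [V [hV hUV]].
  destruct (h V hV) as [q [hq [y [hy <-]]]]; [apply hUV; auto |].
  exists y; split; auto; apply hUV; auto.
Qed.

(** Finitely many of the open sets making up [lambda_P] cover [A]; [D] is the union of the closures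
    in [X] of their cozero-sets. *)
Lemma compact_in_lambda (A : B -> Prop) :
  compact_set A -> (forall p, A p -> lambda_P P X B e p) ->
  exists D : X -> Prop, is_closed D /\ P (subspace X D) /\ forall x, A (e x) -> D x.
Proof.
  intros cA hA.
  apply (compact_ind A (fun W => exists D : X -> Prop, is_closed D /\
    P (subspace X D) /\ forall x, W (e x) -> D x)); auto.
  - intros U V hUV [D [h1 [h2 h3]]]; exists D; auto.
  - exists (fun _ => False); split; [apply closed_empty | split; [| auto]].
    apply P_empty; auto.
  - intros U V [D [h1 [h2 h3]]] [D' [h1' [h2' h3']]].
    exists (fun x => D x \/ D' x); split; [apply closed_or; auto | split].
    + apply P_union; auto.
    + intros x [h | h]; auto.
  - intros p hp; destruct (hA p hp) as [Z [_ [h2 [U [u1 [u2 u3]]]]]].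
    exists U; split; [auto | split; [auto |]].
    exists (closure Z); split; [apply closed_closure | split; [auto |]].
    intros x hx; apply closure_trace; auto.
Qed.

Lemma core_closed : is_closed core.
Proof.
  apply closed_compl, open_local; intros p [Z [h1 [h2 [U [u1 [u2 u3]]]]]].
  exists U; split; [auto | split; [auto |]].
  intros q hq; exists Z; split; [auto | split; [auto | exists U; auto]].
Qed.

Lemma core_inhabited : ~ P X -> exists p, core p.
Proof.
  intro nP; apply NNPP; intro h; apply nP.
  destruct (compact_in_lambda (fun _ => True)) as [D [h1 [h2 h3]]].
  - exact sc_compact.
  - intros p _; apply NNPP; intro k; apply h; exists p; exact k.
  - apply (P_subspace_full P HP X D); auto.
Qed.

(** The trace of the set where [u < 1 / 2] is cozero through the function [max 0 (1 - 2 u)], and its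
    closure in [X] stays where [u <= 1 / 2]. By density that open set lies in the closure of its
    trace. *)
Lemma lambda_of_separation (u : B -> R) (p : B) :
  rcontinuous u -> (forall q, (0 <= u q <= 1)%R) -> u p = 0%R ->
  P (subspace X (fun x => (u (e x) <= 1 / 2)%R)) -> lambda_P P X B e p.
Proof.
  intros hu u01 hp hP.
  exists (fun x => (u (e x) < 1 / 2)%R); split; [| split].
  - exists (fun x => Rmax 0 (1 - 2 * u (e x))); split; [| split].
    + apply (rcontinuous_lipschitz (fun x => u (e x)) (fun t => Rmax 0 (1 - 2 * t)) 2).
      * lra.
      * intros a b; unfold Rmax, Rabs.
        destruct (Rle_dec 0 (1 - 2 * a)), (Rle_dec 0 (1 - 2 * b)); destruct (Rcase_abs _);
          destruct (Rcase_abs _); lra.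
      * apply rcontinuous_comp; auto; apply sc_embedding.
    + intro x; specialize (u01 (e x)); unfold Rmax; destruct (Rle_dec _ _); lra.
    + intro x; unfold Rmax; destruct (Rle_dec _ _); split; intros; try lra.
  - apply (P_closed_subset P HP X _ (fun x => (u (e x) <= 1 / 2)%R)); auto.
    + apply closed_closure.
    + apply closure_min; [| intros; lra].
      apply (open_ext _ (fun x => (1 / 2 < u (e x))%R)); [intro; lra |].
      apply (open_gt (fun x => u (e x))), rcontinuous_comp; auto; apply sc_embedding.
  - exists (fun q => (u q < 1 / 2)%R); split; [apply open_lt; auto | split; [lra |]].
    intros q hq U hU hUq.
    destruct (sc_dense (fun q => U q /\ (u q < 1 / 2)%R) q) as [x [h1 h2]]; auto.
    + apply open_inter; [auto | apply open_lt; auto].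
    + exists (e x); split; [auto | exists x; auto].
Qed.

Lemma core_growth p : locally_P P X -> core p -> growth p.
Proof.
  intros hl hp [x <-]; apply hp.
  destruct (hl x) as [U [hU [hx hPU]]].
  destruct sc_embedding as [_ [_ ho]]; destruct (ho U hU) as [V [hV hUV]].
  destruct (proj2 sc_tychonoff (fun q => ~ V q) (e x)) as [u [u1 [u2 [u3 u4]]]].
  - apply closed_compl; auto.
  - rewrite <- hUV; auto.
  - apply (lambda_of_separation u); auto.
    apply (P_closed_subset P HP X _ (closure U)); auto.
    + apply (open_ext _ (fun x => (1 / 2 < u (e x))%R)); [intro; lra |].
      apply (open_gt (fun x => u (e x))), rcontinuous_comp; auto; apply sc_embedding.
    + intros y hy; apply subset_closure, hUV, NNPP; intro k; apply u4 in k; lra.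
Qed.

(* [maps_to A p y]: the canonical map from [B] to the compactifications of the
   extension [A] sends [p] to the point [y] of [A]. *)
Definition maps_to (A : extension P X) (p : B) (y : ext_space A) : Prop :=
  forall (h : ext_space A -> R) (g : B -> R), rcontinuous h -> rcontinuous g ->
    (forall x, g (e x) = h (ext_map A x)) -> g p = h y.

Definition remainder (A : extension P X) (y : ext_space A) : Prop :=
  ~ exists x, ext_map A x = y.

Definition ext_rel (A : extension P X) (p q : B) : Prop :=
  exists y, remainder A y /\ maps_to A p y /\ maps_to A q y.

(** Supplies the test pairs of [maps_to]: a separating function on the extension is restricted to
    [X] and then extended to [B]. *)
Lemma separate_ext (A : extension P X) (D : ext_space A -> Prop) (y : ext_space A) :
  is_closed D -> ~ D y -> exists h g, rcontinuous h /\ rcontinuous g /\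
    (forall x, g (e x) = h (ext_map A x)) /\ h y = 0%R /\ forall z, D z -> h z = 1%R.
Proof.
  intros hD hy; destruct (ext_tych _ _ A) as [_ hc].
  destruct (hc D y hD hy) as [h [h1 [h2 [h3 h4]]]].
  destruct (stone_cech_extend X B e (fun x => h (ext_map A x)) SC) as [g [g1 g2]].
  - apply rcontinuous_comp; auto; apply (ext_emb _ _ A).
  - auto.
  - exists h, g; auto.
Qed.

Lemma maps_to_unique A p y y' : maps_to A p y -> maps_to A p y' -> y = y'.
Proof.
  intros h1 h2; apply NNPP; intro n.
  destruct (separate_ext A (fun z => z = y') y) as [h [g [k1 [k2 [k3 [k4 k5]]]]]]; auto.
  - apply closed_point, (ext_tych _ _ A).
  - specialize (h1 h g k1 k2 k3); specialize (h2 h g k1 k2 k3).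
    rewrite (k5 y' eq_refl) in h2; lra.
Qed.

Lemma maps_to_base A x : maps_to A (e x) (ext_map A x).
Proof. intros h g _ _ k; apply k. Qed.

(** If [p] differed from [e x], points of [X] near [p] would stay away from [e x], where a
    separating function equals 1, although its extension vanishes at [p]. *)
Lemma maps_to_base_inv A p x : maps_to A p (ext_map A x) -> p = e x.
Proof.
  intro h; apply NNPP; intro n.
  destruct (sc_hausdorff p (e x) n) as [U' [U [h1 [h2 [h3 [h4 h5]]]]]].
  destruct (ext_emb _ _ A) as [_ [_ ho]].
  destruct (ho (fun x => U (e x))) as [V [hV hUV]].
  { apply sc_embedding; auto. }
  destruct (separate_ext A (fun z => ~ V z) (ext_map A x))
    as [f [g [k1 [k2 [k3 [k4 k5]]]]]].
  - apply closed_compl; auto.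
  - rewrite <- hUV; auto.
  - assert (gp := h f g k1 k2 k3).
    destruct (sc_dense (fun q => U' q /\ (g q < 1)%R) p) as [x' [m1 m2]].
    + apply open_inter; [auto | apply open_lt; auto].
    + split; [auto | lra].
    + rewrite k3, k5 in m2; [lra |].
      rewrite <- hUV; intro; eauto.
Qed.

(** A test pair that disagrees at [p] and [y] still disagrees nearby. *)
Lemma maps_to_closed A p y : ~ maps_to A p y -> exists U V, is_open U /\ is_open V /\
  U p /\ V y /\ forall p' y', U p' -> V y' -> ~ maps_to A p' y'.
Proof.
  intro n; apply not_all_ex_not in n; destruct n as [h n].
  apply not_all_ex_not in n; destruct n as [g n].
  assert (k : rcontinuous h /\ rcontinuous g /\
    (forall x, g (e x) = h (ext_map A x)) /\ g p <> h y)
    by (repeat split; tauto || (intro; apply n; tauto)).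
  destruct k as [k1 [k2 [k3 k4]]].
  destruct (rcontinuous_neq g p (h y) k2 k4) as [U [eps [u1 [u2 [u3 u4]]]]].
  destruct (proj1 (rcontinuous_iff h) k1 y eps u3) as [V [v1 [v2 v3]]].
  exists U, V; repeat (split; [assumption |]).
  intros p' y' hp hy hm; specialize (u4 p' hp); specialize (v3 y' hy).
  rewrite (hm h g k1 k2 k3) in u4; lra.
Qed.

(** The closure of [D] in [B] is compact; if none of its points mapped to [y], a neighbourhood of
    [y] would miss [D] as well. *)
Lemma maps_to_lift A (D : X -> Prop) y : closure (image (ext_map A) D) y ->
  exists p, closure (image e D) p /\ maps_to A p y.
Proof.
  intro hy; apply NNPP; intro n.
  destruct (tube (closure (image e D)) (maps_to A) y) as [V [v1 [v2 v3]]].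
  - apply (compact_closed_subset (fun _ => True)); auto; [apply sc_compact |].
    apply closed_closure.
  - intros p hp; apply maps_to_closed; intro; apply n; eauto.
  - destruct (hy V v1 v2) as [z [hz [x [hx <-]]]].
    apply (v3 (e x) (ext_map A x)); auto; [| apply maps_to_base].
    apply subset_closure; exists x; auto.
Qed.

Lemma maps_to_surj A y : exists p, maps_to A p y.
Proof.
  destruct (maps_to_lift A (fun _ => True) y) as [p [_ h]]; eauto.
  apply (ext_dense _ _ A).
Qed.

(** Compactness of the remainder disposes of the existential [y]: each [y] fails to be the image of
    [p] or of [q], and finitely many of the resulting rectangles are intersected. *)
Lemma ext_rel_closed A : closed_rel (ext_rel A).
Proof.
  intros p q n.
  destruct (compact_ind (remainder A) (fun W => exists U V, is_open U /\ is_open V /\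
    U p /\ V q /\ forall p' q' y, U p' -> V q' -> W y -> maps_to A p' y ->
      maps_to A q' y -> False)) as [U [V [h1 [h2 [h3 [h4 h5]]]]]].
  - exact (ext_rem _ _ A).
  - intros W W' hW [U [V [h1 [h2 [h3 [h4 h5]]]]]].
    exists U, V; repeat (split; [assumption |]); eauto.
  - exists (fun _ => True), (fun _ => True).
    split; [apply open_full | split; [apply open_full | tauto]].
  - intros W W' [U [V [h1 [h2 [h3 [h4 h5]]]]]] [U' [V' [h1' [h2' [h3' [h4' h5']]]]]].
    exists (fun x => U x /\ U' x), (fun x => V x /\ V' x).
    split; [apply open_inter; auto | split; [apply open_inter; auto |]].
    split; [auto | split; [auto |]].
    intros p' q' y [a1 a2] [b1 b2] [w | w]; eauto.
  - intros y hy; destruct (classic (maps_to A p y)) as [k | k].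
    + assert (k' : ~ maps_to A q y) by (intro; apply n; exists y; auto).
      destruct (maps_to_closed A q y k') as [V [W [h1 [h2 [h3 [h4 h5]]]]]].
      exists W; split; [auto | split; [auto |]].
      exists (fun _ => True), V; split; [apply open_full |].
      repeat (split; [solve [auto] |]).
      intros p' q' y' _ a b c d; apply (h5 q' y'); auto.
    + destruct (maps_to_closed A p y k) as [V [W [h1 [h2 [h3 [h4 h5]]]]]].
      exists W; split; [auto | split; [auto |]].
      exists V, (fun _ => True); split; [auto | split; [apply open_full |]].
      repeat (split; [solve [auto] |]).
      intros p' q' y' a _ b c d; apply (h5 p' y'); auto.
  - exists U, V; repeat (split; [assumption |]).
    intros p' q' a b [y [k1 [k2 k3]]]; eauto.
Qed.

(** Otherwise no point near [p] maps into the remainder. The trace [Z] of a small closed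
    neighbourhood is then closed in the extension and inherits [P], so [p] lies in [lambda_P]. *)
Lemma core_ext_rel A p : core p -> ext_rel A p p.
Proof.
  intro hp; apply NNPP; intro n; apply hp.
  destruct (ext_rel_closed A p p n) as [U [V [h1 [h2 [h3 [h4 h5]]]]]].
  destruct (proj2 sc_tychonoff (fun q => ~ (U q /\ V q)) p) as [u [u1 [u2 [u3 u4]]]].
  - apply closed_compl, open_inter; auto.
  - tauto.
  - apply (lambda_of_separation u); auto.
    set (Z := fun x => (u (e x) <= 1 / 2)%R).
    assert (hZ : is_closed (image (ext_map A) Z)).
    { apply closed_of_closure; intros y hy.
      destruct (maps_to_lift A Z y hy) as [q [hq hm]].
      assert (hu : (u q <= 1 / 2)%R).
      { apply (closure_min (image e Z) (fun q => (u q <= 1 / 2)%R)); auto.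
        - apply (open_ext _ (fun x => (1 / 2 < u x)%R)); [intro; lra |].
          apply open_gt; auto.
        - intros z [x [hx <-]]; auto. }
      assert (hUV : U q /\ V q).
      { apply NNPP; intro k; apply u4 in k; lra. }
      destruct (classic (remainder A y)) as [k | k].
      - exfalso; apply (h5 q q); try tauto; exists y; auto.
      - apply NNPP in k; destruct k as [x <-].
        exists x; split; auto; unfold Z; rewrite <- (maps_to_base_inv A q x); auto. }
    apply (P_embedding P HP (ext_map A) Z (image (ext_map A) Z)); auto.
    + apply (ext_tych _ _ A).
    + apply (ext_emb _ _ A).
    + intro t; reflexivity.
    + apply P_closed_hereditary; auto; [apply (ext_tych _ _ A) | apply (ext_P _ _ A)].
Qed.

Lemma ext_rel_admissible A : admissible core growth (ext_rel A).
Proof.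
  split.
  - apply ext_rel_closed.
  - intros p q [y [h1 [h2 h3]]]; exists y; auto.
  - intros p q s [y [h1 [h2 h3]]] [y' [h1' [h2' h3']]].
    exists y; split; [auto | split; [auto |]].
    rewrite (maps_to_unique A q y y'); auto.
  - intros p q [y [h1 [h2 h3]]] [x <-]; apply h1; exists x.
    apply (maps_to_unique A (e x)); auto; apply maps_to_base.
  - apply core_ext_rel.
Qed.

(** A map of extensions commutes with the canonical maps and so carries fibres into fibres.
    Conversely, the inclusion makes the image of [y'] independent of the point of [B] chosen above
    it. *)
Lemma ext_le_iff (A A' : extension P X) : ext_le A A' <-> subrel (ext_rel A') (ext_rel A).
Proof.
  split.
  - intros [f [fc ff]].
    assert (hf : forall p y, maps_to A' p y -> maps_to A p (f y)).
    { intros p y hm h g h1 h2 h3; apply (hm (fun z => h (f z)) g); auto.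
      - apply rcontinuous_comp; auto.
      - intro x; rewrite ff; auto. }
    intros p q [y [h1 [h2 h3]]]; exists (f y); split; [| split; auto].
    intros [x hx]; apply h1; exists x.
    assert (k := hf p y h2); rewrite <- hx in k; apply maps_to_base_inv in k; subst p.
    apply (maps_to_unique A' (e x)); auto; apply maps_to_base.
  - intro hsub.
    assert (hex : forall y', exists y, exists p, maps_to A' p y' /\ maps_to A p y).
    { intro y'; destruct (classic (remainder A' y')) as [k | k].
      - destruct (maps_to_surj A' y') as [p hp].
        destruct (hsub p p) as [y [h1 [h2 h3]]]; [exists y'; auto |]; eauto.
      - apply NNPP in k; destruct k as [x <-].
        exists (ext_map A x), (e x); split; apply maps_to_base. }
    destruct (choice _ hex) as [f hf].
    assert (fm : forall p y', maps_to A' p y' -> maps_to A p (f y')).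
    { intros p y' hp; destruct (hf y') as [q [h1 h2]].
      destruct (classic (remainder A' y')) as [k | k].
      - destruct (hsub p q) as [y [m1 [m2 m3]]]; [exists y'; auto |].
        rewrite (maps_to_unique A q (f y') y); auto.
      - apply NNPP in k; destruct k as [x <-].
        apply maps_to_base_inv in hp; apply maps_to_base_inv in h1; subst; auto. }
    exists f; split.
    + intros V hV; apply open_local; intros y0 hy0.
      destruct (separate_ext A (fun z => ~ V z) (f y0))
        as [h [g [k1 [k2 [k3 [k4 k5]]]]]]; [apply closed_compl; auto | auto |].
      (* The points where [g >= 1] form a compact set and none maps to [y0]. So points near [y0]
         come only from places where [g < 1], and [f] sends them into [V]. *)
      destruct (tube (fun p => ~ (g p < 1)%R) (maps_to A') y0) as [W [w1 [w2 w3]]].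
      * apply (compact_closed_subset (fun _ => True)); auto; [apply sc_compact |].
        apply closed_compl, open_lt; auto.
      * intros p hp; apply maps_to_closed; intro hm; apply hp.
        rewrite (fm p y0 hm h g k1 k2 k3); lra.
      * exists W; split; [auto | split; [auto |]]; intros y hy.
        apply NNPP; intro n; destruct (maps_to_surj A' y) as [p hp].
        apply (w3 p y); auto; rewrite (fm p y hp h g k1 k2 k3), k5; auto; lra.
    + intro x; apply (maps_to_unique A (e x)); [apply fm |]; apply maps_to_base.
Qed.

Lemma ext_equiv_rel (A A' : extension P X) : ext_equiv A A' -> ext_rel A = ext_rel A'.
Proof.
  intros [f [[g [fc [gc [gf fg]]]] hf]]; apply subrel_antisym; apply ext_le_iff.
  - exists f; auto.
  - exists g; split; auto; intro x; rewrite <- hf, gf; reflexivity.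
Qed.

(** ** The extension given by a relation *)

Section Construction.

Variable r : B -> B -> Prop.
Hypothesis Hr : admissible core growth r.

(** Equality turns [r] into an equivalence relation on all of [B], whose quotient is compact
    Hausdorff; the extension is then a subspace of it. *)
Definition glue (p q : B) : Prop := p = q \/ r p q.

Lemma glue_refl p : glue p p.
Proof. left; reflexivity. Qed.

Lemma glue_sym p q : glue p q -> glue q p.
Proof. intros [-> | h]; [left | right; apply (adm_sym _ _ _ Hr)]; auto. Qed.

Lemma glue_trans p q s : glue p q -> glue q s -> glue p s.
Proof.
  intros [-> | h]; auto; intros [<- | k]; right; auto.
  apply (adm_trans _ _ _ Hr p q s); auto.
Qed.

Lemma glue_closed : closed_rel glue.
Proof.
  apply closed_rel_or; [| apply (adm_closed _ _ _ Hr)].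
  intros p q n; destruct (closed_rel_diag (fun _ : B => True)) with (p := p) (q := q)
    as [U [V [h1 [h2 [h3 [h4 h5]]]]]].
  - exact sc_hausdorff.
  - apply closed_full.
  - tauto.
  - exists U, V; repeat (split; [assumption |]); intros p' q' a b; specialize (h5 p' q' a b).
    tauto.
Qed.

Definition kept (p : B) : Prop := (exists x, e x = p) \/ r p p.

Definition glued : Space := quotient B glue.

Definition glued_kept (t : glued) : Prop := exists p, kept p /\ cls B glue p = t.

Definition glued_ext : Space := subspace glued glued_kept.

Lemma glued_eq p q : cls B glue p = cls B glue q <-> glue p q.
Proof.
  apply cls_eq; [exact glue_refl | exact glue_sym | exact glue_trans].
Qed.

Lemma tychonoff_glued : tychonoff glued.
Proof.
  apply tychonoff_quotient; [exact glue_refl | exact glue_sym | exact glue_trans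
    | exact glue_closed | exact sc_compact | exact sc_hausdorff].
Qed.

Lemma tychonoff_glued_ext : tychonoff glued_ext.
Proof. apply tychonoff_subspace, tychonoff_glued. Qed.

Definition glued_map (x : X) : glued_ext :=
  exist _ (cls B glue (e x)) (ex_intro _ (e x) (conj (or_introl (ex_intro _ x eq_refl)) eq_refl)).

Lemma domain_closed : is_closed (fun p => r p p).
Proof.
  apply open_local; intros p n.
  destruct (adm_closed _ _ _ Hr p p n) as [U [V [h1 [h2 [h3 [h4 h5]]]]]].
  exists (fun q => U q /\ V q); split; [apply open_inter; auto | split; auto].
  intros y [a b]; auto.
Qed.

Lemma glue_base p x : glue p (e x) -> p = e x.
Proof.
  intros [h | h]; auto; exfalso.
  apply (adm_sym _ _ _ Hr), (adm_support _ _ _ Hr) in h; apply h; eauto.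
Qed.

Lemma glued_embedding : embedding glued_map.
Proof.
  split; [| split].
  - apply continuous_into_subspace; intros V hV.
    apply (proj1 sc_embedding (fun p => V (cls B glue p))); exact hV.
  - intros x y h; apply (f_equal (@proj1_sig _ _)) in h; simpl in h.
    apply glued_eq, glue_base in h; apply sc_embedding; auto.
  - intros U hU; destruct sc_embedding as [_ [_ ho]].
    destruct (ho U hU) as [V [hV hUV]].
    (* Off the domain of [r] gluing is equality, so removing the closed domain makes [V] saturated
       without losing a point of [X]. *)
    set (W := fun t : glued => exists p, cls B glue p = t /\ V p /\ ~ r p p).
    assert (hW : forall p, W (cls B glue p) <-> V p /\ ~ r p p).
    { intro p; split; [| exists p; auto].
      intros [q [h1 [h2 h3]]]; apply glued_eq in h1; destruct h1 as [<- | h1]; auto.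
      destruct h3; apply (refl_of_rel _ _ _ _ _ _ Hr h1). }
    exists (fun y => W (proj1_sig y)); split.
    + exists W; split; [| tauto].
      apply (open_ext _ (fun p => V p /\ ~ r p p)); [intro p; symmetry; apply hW |].
      apply open_inter; [auto | apply domain_closed].
    + intro x; simpl; rewrite hW, hUV; split; [| tauto].
      intro h; split; auto; intro k.
      apply (adm_support _ _ _ Hr) in k; apply k; eauto.
Qed.

Lemma glued_dense : dense_map glued_map.
Proof.
  intros [t ht] U [V [hV hUV]] hU; assert (hV' := proj1 (hUV _) hU); simpl in hV'.
  destruct (cls_surj B glue t) as [p hp].
  destruct (sc_dense (fun p => V (cls B glue p)) p hV) as [x hx].
  - rewrite hp; exact hV'.
  - exists (glued_map x); split; [apply hUV; exact hx | exists x; auto].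
Qed.

Lemma kept_saturated p q : glue p q -> kept q -> kept p.
Proof.
  intros h [[x <-] | k].
  - apply glue_base in h; left; eauto.
  - destruct h as [-> | h]; right; auto; apply (refl_of_rel _ _ _ _ _ _ Hr h).
Qed.

Lemma glued_remainder (y : glued_ext) : (~ exists x, glued_map x = y) <->
  exists p, r p p /\ cls B glue p = proj1_sig y.
Proof.
  destruct y as [t [p [hp ht]]]; simpl; split.
  - intro n; exists p; split; auto; destruct hp as [[x <-] | h]; auto.
    destruct n; exists x; apply sig_eq; exact ht.
  - intros [q [h1 h2]] [x hx]; apply (f_equal (@proj1_sig _ _)) in hx; simpl in hx.
    rewrite <- hx in h2; apply glued_eq, glue_base in h2; subst q.
    apply (adm_support _ _ _ Hr) in h1; apply h1; eauto.
Qed.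

Lemma glued_remainder_compact : compact_set (fun y => ~ exists x, glued_map x = y).
Proof.
  apply (compact_ext (fun y : glued_ext =>
    (fun t => exists p, r p p /\ cls B glue p = t) (proj1_sig y))).
  { intro y; symmetry; apply glued_remainder. }
  apply (@compact_subspace glued glued_kept (fun t => exists p, r p p /\ cls B glue p = t)).
  - apply (@compact_image B glued (cls B glue) (fun p => r p p)); auto.
    + intros V hV x _ hx; exists (fun p => V (cls B glue p)); auto.
    + intros x hx; exists x; auto.
    + apply (compact_closed_subset (fun _ => True)); auto; [apply sc_compact |].
      apply domain_closed.
  - intros t [p [h1 h2]]; exists p; split; [right |]; auto.
Qed.

Definition glued_proj (z : subspace B kept) : glued_ext :=
  exist _ (cls B glue (proj1_sig z)) (ex_intro _ (proj1_sig z) (conj (proj2_sig z) eq_refl)).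

(** A closed map restricted to a saturated set stays closed. Hence [P] of the extension depends only
    on [kept], that is, on the domain of [r]. *)
Lemma glued_proj_perfect : perfect_surjection glued_proj.
Proof.
  split; [| split; [| split]].
  - apply continuous_into_subspace; intros V hV.
    exists (fun p => V (cls B glue p)); split; [exact hV | intro; reflexivity].
  - intros A [U [hU h]].
    assert (hc : @is_closed glued (image (cls B glue) (fun p => ~ U p))).
    { apply (@closed_map_of_compact B glued (cls B glue)).
      - exact sc_compact.
      - apply tychonoff_glued.
      - apply continuous_cls.
      - apply closed_compl; auto. }
    exists (fun t => ~ image (cls B glue) (fun p => ~ U p) t); split; [exact hc |].
    intros [t ht]; simpl; split; intros n k; apply n.
    + destruct k as [p [h1 h2]].
      assert (hp : kept p).
      { destruct ht as [q [k1 k2]]; apply kept_saturated with q; auto.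
        apply glued_eq; congruence. }
      exists (exist _ p hp); split; [| apply sig_eq; exact h2].
      apply NNPP; intro m; apply h1; exact (proj1 (h (exist _ p hp)) m).
    + destruct k as [[p hp] [h1 h2]]; exists p.
      split; [| exact (f_equal (@proj1_sig _ _) h2)].
      intro m; exact (proj2 (h (exist _ p hp)) m h1).
  - intros [t [p [hp ht]]]; exists (exist _ p hp); apply sig_eq; exact ht.
  - intros [t [p [hp ht]]].
    apply (compact_ext (fun z : subspace B kept => glue p (proj1_sig z))).
    { intros [q hq]; simpl; rewrite <- glued_eq; split; intro h.
      - apply sig_eq; simpl; congruence.
      - apply (f_equal (@proj1_sig _ _)) in h; simpl in h; congruence. }
    apply compact_subspace.
    + apply (compact_closed_subset (fun _ => True)); auto; [apply sc_compact |].
      apply closed_rel_class, glue_closed.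
    + intros q hq; apply kept_saturated with p; auto; apply glue_sym; auto.
Qed.

Lemma P_glued_iff : P (subspace B kept) <-> P glued_ext.
Proof.
  apply (P_perfect P HP glued_proj).
  - apply tychonoff_subspace, sc_tychonoff.
  - apply tychonoff_glued_ext.
  - apply glued_proj_perfect.
Qed.

(* If all of the remainder is one point, condition (W) applies there: the
   complement of a neighbourhood is closed in [X] and covered by finitely many
   of the sets defining [lambda_P]. *)
Lemma P_one_point (p0 : B) : r p0 p0 -> (forall p q, r p p -> r q q -> r p q) -> P glued_ext.
Proof.
  intros h0 htot; assert (k0 : kept p0) by (right; auto).
  destruct HP as [_ [_ [_ hW]]].
  apply (hW glued_ext (glued_proj (exist _ p0 k0))
    (fun U => is_open U /\ U (glued_proj (exist _ p0 k0)))).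
  - apply tychonoff_glued_ext.
  - auto.
  - intros V h1 h2; exists V; auto.
  - intros U [[V [hV hUV]] hU].
    assert (hV' : is_open (fun p => V (cls B glue p))) by exact hV.
    assert (hK : forall p, r p p -> V (cls B glue p)).
    { intros p hp; replace (cls B glue p) with (cls B glue p0).
      - exact (proj1 (hUV _) hU).
      - apply glued_eq; right; auto. }
    destruct (compact_in_lambda (fun p => ~ V (cls B glue p))) as [D [d1 [d2 d3]]].
    + apply (compact_closed_subset (fun _ => True)); auto; [apply sc_compact |].
      apply closed_compl; auto.
    + intros p hp; apply NNPP; intro n; apply hp, hK, (adm_refl _ _ _ Hr); exact n.
    + apply (P_embedding P HP glued_map (fun x => ~ V (cls B glue (e x)))).
      * auto.
      * apply tychonoff_glued_ext.
      * apply glued_embedding.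
      * intro y; rewrite hUV; split.
        -- intro n; destruct (classic (exists x, glued_map x = y)) as [[x <-] | k].
           ++ exists x; auto.
           ++ apply glued_remainder in k; destruct k as [p [k1 k2]].
              destruct n; rewrite <- k2; auto.
        -- intros [x [h <-]]; exact h.
      * apply (P_closed_subset P HP X _ D); auto.
        apply closed_compl; apply (proj1 sc_embedding (fun p => V (cls B glue p))); auto.
Qed.

End Construction.

(** The relation [s] has the domain of [r] but a single class. Both extensions are perfect images of
    the same subspace, so [P] passes over from the one-point case. *)
Lemma P_glued_ext (r : B -> B -> Prop) :
  ~ P X -> admissible core growth r -> P (glued_ext r).
Proof.
  intros nP Hr; destruct (core_inhabited nP) as [p0 h0].
  set (s := fun p q => r p p /\ r q q).
  assert (Hs : admissible core growth s).
  { split; unfold s; try tauto.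
    - apply closed_rel_square, domain_closed; auto.
    - intros p q [h _]; apply (adm_support _ _ _ Hr p p); auto.
    - intros p h; split; apply (adm_refl _ _ _ Hr); auto. }
  apply P_glued_iff; auto.
  replace (kept r) with (kept s).
  - apply P_glued_iff; auto; apply (P_one_point s Hs p0).
    + split; apply (adm_refl _ _ _ Hr); auto.
    + unfold s; tauto.
  - apply functional_extensionality; intro p; apply propositional_extensionality.
    unfold kept, s; tauto.
Qed.

Definition glued_extension (nP : ~ P X) (r : B -> B -> Prop)
    (Hr : admissible core growth r) : extension P X :=
  {| ext_space := glued_ext r;
     ext_map := glued_map r;
     ext_tych := tychonoff_glued_ext r Hr;
     ext_emb := glued_embedding r Hr;
     ext_dense := glued_dense r;
     ext_rem := glued_remainder_compact r Hr;
     ext_P := P_glued_ext r nP Hr |}.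

(** One direction tests with functions on the compact quotient; the other uses density of [X], on
    which the two functions of a test pair agree. *)
Lemma maps_to_glued nP r Hr p (y : glued_ext r) :
  maps_to (glued_extension nP r Hr) p y <-> cls B (glue r) p = proj1_sig y.
Proof.
  split.
  - intro hm; apply NNPP; intro n.
    destruct (proj2 (tychonoff_glued r Hr) (fun t => t = proj1_sig y) (cls B (glue r) p))
      as [h [h1 [h2 [h3 h4]]]]; auto.
    + apply closed_point, tychonoff_glued; auto.
    + assert (k : h (cls B (glue r) p) = h (proj1_sig y)).
      { apply (hm (fun z => h (proj1_sig z)) (fun p => h (cls B (glue r) p))).
        - apply (rcontinuous_comp (@proj1_sig _ _ : glued_ext r -> glued r)); auto.
          apply continuous_proj1.
        - apply (rcontinuous_comp (cls B (glue r) : B -> glued r)); auto.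
          apply continuous_cls.
        - reflexivity. }
      rewrite h3, h4 in k; auto; lra.
  - intros hp h g h1 h2 h3; apply NNPP; intro n.
    destruct (rcontinuous_neq g p (h y) h2 n) as [U [eps [u1 [u2 [u3 u4]]]]].
    destruct (proj1 (rcontinuous_iff h) h1 y eps u3) as [V [[W [w1 w2]] [v2 v3]]].
    destruct (sc_dense (fun q => U q /\ W (cls B (glue r) q)) p) as [x [m1 m2]].
    + apply open_inter; [auto | exact w1].
    + split; auto; rewrite hp; apply w2; auto.
    + specialize (u4 _ m1); specialize (v3 (glued_map r x) (proj2 (w2 (glued_map r x)) m2)).
      rewrite h3 in u4; simpl in u4; lra.
Qed.

Lemma ext_rel_surj r : ~ P X -> admissible core growth r ->
  exists A : extension P X, ext_rel A = r.
Proof.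
  intros nP Hr; exists (glued_extension nP r Hr); apply subrel_antisym.
  - intros p q [y [h1 [h2 h3]]].
    apply maps_to_glued in h2; apply maps_to_glued in h3.
    apply (glued_remainder r Hr) in h1; destruct h1 as [p0 [k1 k2]].
    assert (k3 : glue r p p0) by (apply glued_eq; auto; congruence).
    assert (k4 : glue r q p0) by (apply glued_eq; auto; congruence).
    assert (a1 : r p p0) by (destruct k3 as [-> | k3]; auto).
    assert (a2 : r q p0) by (destruct k4 as [-> | k4]; auto).
    apply (adm_trans _ _ _ Hr p p0 q); auto; apply (adm_sym _ _ _ Hr); auto.
  - intros p q h; destruct (refl_of_rel _ _ _ _ _ _ Hr h) as [hp hq].
    exists (glued_proj r (exist _ p (or_intror hp))); split; [| split].
    + apply (glued_remainder r Hr); exists p; auto.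
    + apply maps_to_glued; reflexivity.
    + apply maps_to_glued; apply glued_eq; auto; right.
      apply (adm_sym _ _ _ Hr); auto.
Qed.

Lemma stone_cech_setting : locally_P P X -> ~ P X -> setting core growth.
Proof.
  intros hl nP; split.
  - exact sc_hausdorff.
  - exact core_closed.
  - intros p; apply core_growth; auto.
  - apply core_inhabited; auto.
Qed.

Lemma ext_rel_section : locally_P P X -> ~ P X ->
  exists S : (B -> B -> Prop) -> extension P X,
    forall r, admissible core growth r -> ext_rel (S r) = r.
Proof.
  intros hl nP.
  assert (HS := stone_cech_setting hl nP).
  apply choice with (Q := fun r A => admissible core growth r -> ext_rel A = r).
  intro r; destruct (classic (admissible core growth r)) as [h | h].
  - destruct (ext_rel_surj r nP h) as [A hA]; eauto.
  (* Default for a relation that is not admissible: the extension of the least relation, which is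
     [pair_rel core c c] for [c] in [core]. *)
  - destruct (set_inh _ _ HS) as [c hc].
    destruct (ext_rel_surj (pair_rel core c c) nP) as [A hA].
    + apply admissible_pair; auto; apply HS; auto.
    + exists A; tauto.
Qed.

End StoneCech.

Theorem theorem4p12 (P : Space -> Prop) (X Y bX bY : Space)
  (eX : X -> bX) (eY : Y -> bY) :
  compactness_like P ->
  tychonoff X -> tychonoff Y ->
  locally_P P X -> locally_P P Y ->
  ~ P X -> ~ P Y ->
  is_stone_cech X bX eX -> is_stone_cech Y bY eY ->
  ext_order_isomorphic P X Y ->
  homeomorphic (subspace bX (fun p => ~ lambda_P P X bX eX p))
               (subspace bY (fun p => ~ lambda_P P Y bY eY p)).
Proof.
  intros HP tX tY lX lY nX nY sX sY [Phi [_ [hle hsurj]]].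
  assert (HX := stone_cech_setting P X bX eX HP tX sX lX nX).
  assert (HY := stone_cech_setting P Y bY eY HP tY sY lY nY).
  destruct (ext_rel_section P X bX eX HP tX sX lX nX) as [SX hSX].
  destruct (ext_rel_section P Y bY eY HP tY sY lY nY) as [SY hSY].
  (* [Psi] inverts [Phi] up to [ext_equiv] only; equivalent extensions have equal relations, so on
     relations the inverse is exact. *)
  destruct (choice _ hsurj) as [Psi hPsi].
  set (relX := ext_rel P X bX eX); set (relY := ext_rel P Y bY eY).
  assert (hsub : forall A A', subrel (relY (Phi A)) (relY (Phi A')) <->
    subrel (relX A) (relX A')).
  { intros A A'; unfold relX, relY.
    rewrite <- (ext_le_iff P X bX eX sX), <- (ext_le_iff P Y bY eY sY).
    symmetry; apply hle. }
  assert (heq : forall A A', relY (Phi A) = relY (Phi A') <-> relX A = relX A').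
  { intros A A'; split; intro h; apply subrel_antisym; apply hsub;
      rewrite h; intros p q k; exact k. }
  assert (hinv : forall r, admissible (core P Y bY eY) (growth Y bY eY) r ->
    relY (Phi (Psi (SY r))) = r).
  { intros r hr; rewrite <- (hSY r hr) at 2.
    apply (ext_equiv_rel P Y bY eY sY); apply hPsi. }
  apply (rel_iso_homeomorphic (core P X bX eX) (growth X bX eX)
    (core P Y bY eY) (growth Y bY eY)
    (fun r => relY (Phi (SX r))) (fun r => relX (Psi (SY r)))); auto.
  assert (admX : forall A, admissible (core P X bX eX) (growth X bX eX) (relX A)).
  { intro A; apply ext_rel_admissible; auto. }
  assert (admY : forall A, admissible (core P Y bY eY) (growth Y bY eY) (relY A)).
  { intro A; apply ext_rel_admissible; auto. }
  split; auto.
  - intros r hr; rewrite <- (hSX r hr) at 2; apply heq; rewrite hinv; auto.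
  - intros r hr; rewrite <- (hinv r hr) at 2; apply heq; apply hSX, admX.
  - intros r s hr hs h; apply hsub; unfold relX; rewrite !hSX; auto.
  - intros r s hr hs h; apply hsub; rewrite !hinv; auto.
Qed.
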